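(* Let $G=(V,E)$ be a countably infinite connected graph with finite degrees and let $p:\mathcal C_\to(G)\to[0,1]$ be a weight function on oriented cycles satisfying the uniform loop assumption (stated in the context). There exists $0<\iota<1$ such that for every $m$ large enough and all edges $e_1=(x_1,y_1)$, $e_2=(x_2,y_2)$ of $G$ with $d(\{x_1,y_1\},\{x_2,y_2\})\ge m$, $$\mu_p(e_2\in\mathsf F)\,\mu_p(e_1\in\mathsf F)-\iota^m\ \le\ \mu_p(\{e_2\in\mathsf F\}\cap\{e_1\in\mathsf F\})\ \le\ \mu_p(e_2\in\mathsf F)\,\mu_p(e_1\in\mathsf F)+\iota^m ,$$ where $\mathsf F$ denotes the random configuration with law $\mu_p$.
   Context: **Cycles.** $\mathcal C_\to(G)$ is the set of oriented simple cycles of $G$. A back-and-forth path $(v,u,v)$ along one edge is not a cycle and is by convention given weight $p=0$. A cycle-rooted spanning forest (CRSF) of $G$ is a subgraph containing all vertices, each of whose connected components contains exactly one cycle. **Uniform loop assumption** (for a weight function $w$; here $w=p$). There exist $\alpha>0$, $\beta>0$, $M,M'>0$, $C>0$, $d\in\mathbb N$, a family $\Gamma$ of oriented cycles of $G$, and for every $x\in V$ an increasing sequence $(B_n^x)_{n\ge1}$ of finite connected induced subgraphs of $G$ containing $x$ and exhausting $G$ such that: - for every $\gamma\in\Gamma$, $\alpha\le w(\gamma)\le1$; - for every $x\in V$, $n\ge1$ and $v\in\partial B_n^x$ there is a cycle $\gamma_v\in\Gamma$ with all vertices in $B_{n+1}^x\setminus(B_n^x\cup\partial B_{n+1}^x)$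 such that the probability that a simple random walk started at $v$ makes this loop, i.e. $\mathbb P_v((X_1,\dots,X_{|\gamma_v|})=\gamma_v)$, is greater than $\beta$ (with $\gamma_v$ written as a closed vertex sequence $(x_1,\dots,x_k)$, $x_k=x_1$, $|\gamma_v|=k$); - for every $x\in V$ and $n\ge1$, $M'n\le d(x,\partial B_n^x)\le Mn$ and $|\partial B_n^x|\le Cn^d$. Here $\partial B$ is the set of vertices of $B$ having a neighbour in $G$ outside $B$, $d(\cdot,\cdot)$ is the graph distance (between vertices or sets of vertices), and $\mathbb P_v$ is the law of the simple random walk $(X_k)_{k\ge0}$ on $G$ with $X_0=v$. **$p$-loop-erased random walk with boundary condition $W\subset V$.** Let $(X_n)_{n\ge0}$ be a simple random walk on $G$ started at $x$ and $(Y_n)$ i.i.d. uniform on $[0,1]$, independent of $(X_n)$. Maintain a current self-avoiding path, initially $(x)$. At time $n+1$, if the current path is $(x_0,\dots,x_l)$ and $X_{n+1}\notin\{x_0,\dots,x_l\}$, append $X_{n+1}$. If $X_{n+1}=x_i$, a loop $\gamma=(x_i,\dots,x_l,x_i)$ is closed at time $n+1$: if $Y_{n+1}\le p(\gamma)$ the loop is kept and the walk stops; otherwise the loop is erased and the path becomes $(x_0,\dots,x_i)$. The walk also stops at $T_W=\min\{k\ge0:X_k\in W\}$. The $p$-loop-erased random walk with boundary condition $W$ is the path at the stopping time (together with the kept loop, if the walk stopped by keeping a loop). **The measure $\mu_p$.** Let $(v_i)_{i\ge1}$ be an enumeration of $V$. Take independent families $(X^{(x)}_n)_n$, $(Y^{(x)}_n)_n$,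 $x\in V$, where for each $x\in V$, $(X^{(x)}_n)_n$ is a simple random walk on $G$ started at $x$ and $(Y^{(x)}_n)_n$ is a sequence of i.i.d. random variables uniform on $[0,1]$. Put $\mathsf F_0=\emptyset$ and $\mathsf F_i=\mathsf F_{i-1}\cup L(v_i)$, where $L(v_i)$ is the $p$-loop-erased random walk started at $v_i$ built from $(X^{(v_i)},Y^{(v_i)})$ with boundary condition $V(\mathsf F_{i-1})$. Let $\mathsf F=\bigcup_i\mathsf F_i$, a random CRSF of $G$. Under the uniform loop assumption for $w=p$, its law on $\{0,1\}^E$ does not depend on the enumeration and is denoted $\mu_p$.
   Formalization: In the uniform loop assumption, the bound d(x,∂B_n^x) ≤ Mn is required of every vertex of ∂B_n^x, not only of the nearest one; with the nearest-vertex reading B_n^x can reach arbitrarily far and the decay claim fails. *)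

(* Defs.v *)
From HB Require Import structures.
From mathcomp Require Import all_boot all_order all_algebra.
From mathcomp Require Import finmap.
From mathcomp Require Import all_classical all_reals all_analysis.

Set Implicit Arguments.
Unset Strict Implicit.
Unset Printing Implicit Defensive.

Import Order.TTheory GRing.Theory Num.Theory.
Import numFieldNormedType.Exports.

Local Open Scope classical_set_scope.
Local Open Scope ring_scope.

Definition neighbours (V : countType) (e : rel V) (x : V) : set V :=
  [set y | e x y].

Definition deg (V : countType) (e : rel V) (x : V) : nat :=
  #|` fset_set (neighbours e x)|%fset.

Definition connected_in (V : countType) (e : rel V) (B : set V) : Prop :=
  forall x y, B x -> B y ->
    exists s, [/\ path e x s, last x s = y & forall z, z \in s -> B z].

Definition infinite_graph (V : countType) (e : rel V) : Prop :=
  [/\ infinite_set [set: V], symmetric e, irreflexive e,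
      forall x, finite_set (neighbours e x) & connected_in e [set: V]].

Definition walk_of_length (V : countType) (e : rel V) (x y : V) (k : nat) :
  Prop := exists s, [/\ path e x s, last x s = y & size s = k].

(* The value 0 for unconnected vertices is a dummy: the graphs considered are
   connected. *)
Definition gdist (V : countType) (e : rel V) (x y : V) : nat :=
  match pselect (exists k, `[< walk_of_length e x y k >]) with
  | left h => ex_minn h
  | right _ => 0%N
  end.

(* [d(A, B) >= m] for the graph distance between two sets of vertices. *)
Definition far_apart (V : countType) (e : rel V) (m : nat) (A B : set V) :
  Prop := forall x y, A x -> B y -> (m <= gdist e x y)%N.

Definition vboundary (V : countType) (e : rel V) (B : set V) : set V :=
  [set x | B x /\ exists2 y, e x y & ~ B y].

(* [:: x_1; ...; x_k] stands for the closed path (x_1, ..., x_k, x_1). An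
   oriented cycle has no base point: it is such a sequence up to [rot]. *)
Definition is_cycle (V : countType) (e : rel V) (c : seq V) : bool :=
  [&& (2 < size c)%N, uniq c & cycle e c].

Definition cycle_weight (R : realType) (V : countType) (e : rel V)
    (p : seq V -> R) : Prop :=
  forall c, is_cycle e c ->
    0 <= p c <= 1 /\ forall k, p (rot k c) = p c.

(* Back-and-forth paths along an edge are not cycles and get weight 0. *)
Definition loop_weight (R : realType) (V : countType) (e : rel V)
    (p : seq V -> R) (c : seq V) : R :=
  if is_cycle e c then p c else 0.

(* The probability [P_x ((X_1, ..., X_k) = s)]. *)
Fixpoint srw_prob (R : realType) (V : countType) (e : rel V) (x : V)
    (s : seq V) : R :=
  if s is y :: s' then
    if e x y then (deg e x)%:R^-1 * srw_prob R e y s' else 0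
  else 1.

Definition is_srw (R : realType) (V : countType) (e : rel V) (x : V)
    d (T : measurableType d) (P : probability T R) (X : nat -> T -> V) : Prop :=
  [/\ forall n y, measurable (X n @^-1` [set y]),
      P (X 0%N @^-1` [set x]) = 1%E &
      forall s : seq V,
        P [set w | [seq X n.+1 w | n <- iota 0 (size s)] = s] =
        (srw_prob R e x s)%:E].

(* The condition on [d(x, \partial B)] is required of every vertex of the
   boundary: controlling only the boundary vertex nearest to x would leave the
   sets B unconfined. *)
Definition uniform_loop (R : realType) (V : countType) (e : rel V)
    (p : seq V -> R) : Prop :=
  exists (alpha beta M M' C : R) (d : nat) (Gamma : set (seq V))
         (B : V -> nat -> set V),
    [/\ [/\ 0 < alpha, 0 < beta, 0 < M, 0 < M' & 0 < C],
        forall c, Gamma c -> is_cycle e c /\ alpha <= p c <= 1,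
        forall x,
          [/\ forall n, (0 < n)%N ->
                [/\ finite_set (B x n), connected_in e (B x n) & B x n x],
              forall n, (0 < n)%N -> B x n `<=` B x n.+1 &
              forall y, exists2 n, (0 < n)%N & B x n y],
        forall x n v, (0 < n)%N -> vboundary e (B x n) v ->
          exists c, [/\ Gamma c,
            forall z, z \in c ->
              (B x n.+1 `\` (B x n `|` vboundary e (B x n.+1))) z &
            beta < srw_prob R e v (rcons c (head v c))] &
        forall x n, (0 < n)%N ->
          (forall v, vboundary e (B x n) v ->
             M' * n%:R <= (gdist e x v)%:R <= M * n%:R) /\
          (#|` fset_set (vboundary e (B x n))|%fset)%:R <= C * n%:R ^+ d].

(* [Active s]: the walk runs and its current path is s.
   [AtBoundary s]: it has stopped in W, with path s.
   [LoopKept s y]: it has stopped with path s by keeping the loop closed by the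
   step from the end of s to the vertex y of s. *)
Inductive lerw_state (V : Type) : Type :=
  | Active of seq V
  | AtBoundary of seq V
  | LoopKept of seq V & V.

Definition stop_in (V : countType) (W : set V) (y : V) (s : seq V) :
  lerw_state V := if y \in W then AtBoundary s else Active s.

Definition lerw_step (R : realType) (V : countType) (e : rel V)
    (p : seq V -> R) (W : set V) (st : lerw_state V) (y : V) (u : R) :
    lerw_state V :=
  match st with
  | Active s =>
      if y \notin s then stop_in W y (rcons s y)
      else if u <= loop_weight e p (drop (index y s) s) then LoopKept s y
      else stop_in W y (take (index y s).+1 s)
  | _ => st
  end.

Fixpoint lerw (R : realType) (V : countType) (e : rel V) (p : seq V -> R)
    (W : set V) (X : nat -> V) (Y : nat -> R) (n : nat) : lerw_state V :=
  if n is n'.+1 then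
    lerw_step e p W (lerw e p W X Y n') (X n) (Y n)
  else stop_in W (X 0%N) [:: X 0%N].

(* A walk that never stops (a null event) contributes nothing. *)
Definition state_vertices (V : Type) (st : lerw_state V) : seq V :=
  match st with
  | Active _ => [::]
  | AtBoundary s | LoopKept s _ => s
  end.

Definition state_steps (V : Type) (st : lerw_state V) : seq (V * V) :=
  match st with
  | Active _ => [::]
  | AtBoundary s => zip s (behead s)
  | LoopKept s y => zip s (rcons (behead s) y)
  end.

Record edge (V : countType) (e : rel V) : Type := Edge {
  ends : set V;
  endsP : exists x y, e x y /\ ends = [set x; y] }.

Definition edge_cylinders (V : countType) (e : rel V) :
    set (set (set (edge e))) :=
  [set [set F : set (edge e) | F a] | a in [set: edge e]].

(* [{0,1}^E] with its product sigma-algebra. *)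
Definition config (V : countType) (e : rel V) :=
  g_sigma_algebraType (@edge_cylinders V e).

Definition edge_open (V : countType) (e : rel V) (a : edge e) :
  set (config e) := [set F : set (edge e) | F a].

(* The vertices and edges of F_i; the enumeration v starts at index 0, so that
   F_(i+1) adds the walk from [v i]. *)
Fixpoint forest (R : realType) (V : countType) (e : rel V) (p : seq V -> R)
    (v : nat -> V) (X : V -> nat -> V) (Y : V -> nat -> R) (i : nat) :
    set V * set (edge e) :=
  if i is i'.+1 then
    let F := forest e p v X Y i' in
    let L := lerw e p F.1 (X (v i')) (Y (v i')) in
    (F.1 `|` [set z | exists n, z \in state_vertices (L n)],
     F.2 `|` [set a | exists n x y,
                (x, y) \in state_steps (L n) /\ ends a = [set x; y]])
  else (set0, set0).

Definition full_forest (R : realType) (V : countType) (e : rel V)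
    (p : seq V -> R) (v : nat -> V) (X : V -> nat -> V) (Y : V -> nat -> R) :
    config e := \bigcup_i (forest e p v X Y i).2.

Definition mutually_independent (R : realType) d (T : measurableType d)
    (P : probability T R) (I : choiceType) (S : I -> set (set T)) : Prop :=
  forall (J : {fset I}) (A : I -> set T), (forall i, i \in J -> S i (A i)) ->
    P (\bigcap_(i in [set` J]) A i) = (\prod_(i <- J) P (A i))%E.

Definition walk_sigma (V : countType) d (T : measurableType d)
    (X : nat -> T -> V) : set (set T) :=
  <<s [set A | exists n y, A = X n @^-1` [set y]] >>.

(* [X x] and [Y x n], for all x and n, are mutually independent; each [X x] is a
   simple random walk started at x, each [Y x n] is uniform on [0, 1]. *)
Definition driving_noise (R : realType) (V : countType) (e : rel V)
    d (T : measurableType d) (P : probability T R)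
    (X : V -> nat -> T -> V) (Y : V -> nat -> {RV P >-> R}) : Prop :=
  [/\ forall x, is_srw e x P (X x),
      forall x n (A : set R), measurable A ->
        distribution P (Y x n) A = uniform_prob (@ltr01 R) A &
      mutually_independent P (fun i : V + V * nat =>
        match i with
        | inl x => walk_sigma (X x)
        | inr xn => preimage_set_system setT (Y xn.1 xn.2) measurable
        end)].

(* The law of F does not depend on the enumeration v of V nor on the realisation
   of the noise; asking for one of them assumes nothing about this invariance. *)
Definition is_mu_p (R : realType) (V : countType) (e : rel V) (p : seq V -> R)
    (mu : probability (config e) R) : Prop :=
  exists (v : nat -> V) (d : measure_display) (T : measurableType d)
         (P : probability T R) (X : V -> nat -> T -> V)
         (Y : V -> nat -> {RV P >-> R}),
    [/\ bijective v, driving_noise e X Y &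
        forall A : set (config e), measurable A ->
          mu A = P [set w | A (full_forest p v (fun x n => X x n w)
                                                 (fun x n => Y x n w))]].

(* Main.v *)
(* An edge of the forest is an arrow leaving one of its ends, so an event on an edge depends
   only on the two walks started at its ends, provided that these walks come first. They may
   be taken first because the algorithm is abelian. Let its state be the partial map of the
   visible arrows, where a move reveals the arrow of an undefined vertex [t] by a uniform
   neighbour and erases the cycle [c] that it closes with probability [1 - p c]. Moves at
   different vertices commute, as a cycle closed at one of them contains no arrow of the
   other; so any two orders of the starts give the same law, already when the total number
   of moves is bounded.

   The range of a walk has an exponential tail. When the walk visits a boundary vertex [v]
   of some [B x n], whatever its past, with probability at least [beta ^ 2] it next follows
   the cycle of [v] twice, which closes this cycle up to rotation and so stops the walk with
   conditional probability at least [alpha]. On its way to distance [r] the walk crosses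
   linearly many of these boundaries, and each vertex lies in a bounded number of them,
   because it has a different neighbour for each.

   If both pairs of walks stay near their starts, the second pair does not notice the first.
   This gives the upper bound, and applied to the complement of the second event, the lower
   bound. *)

Require Import Defs.
From mathcomp Require Import all_boot all_order all_algebra.
From mathcomp Require Import finmap.
From mathcomp Require Import all_classical all_reals all_analysis.
From mathcomp Require Import ring lra zify.

Set Implicit Arguments.
Unset Strict Implicit.
Unset Printing Implicit Defensive.

Import Order.TTheory GRing.Theory Num.Theory.
Import numFieldNormedType.Exports.

Local Open Scope classical_set_scope.
Local Open Scope ring_scope.

(** * Partial arrow maps *)

Section Arrows.
Variable V : countType.
Implicit Types (A B : V -> option V) (s c : seq V) (x y z t : V).

Definition arrow A : rel V := [rel a b | A a == Some b].
Definition upd A t y : V -> option V := fun z => if z == t then Some y else A z.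
Definition del A c : V -> option V := fun z => if z \in c then None else A z.

Definition reach A x z := exists2 s, path (arrow A) x s & last x s = z.

(* The vertices from [y] to [t], and [::] if [y] does not lead to [t]. *)
Definition chain A y t : seq V :=
  match pselect (exists s, path (arrow A) y s && (last y s == t)) with
  | left h => y :: projT1 (cid h)
  | right _ => [::]
  end.

Lemma arrow_cons A x y s :
  path (arrow A) x (y :: s) = (A x == Some y) && path (arrow A) y s.
Proof. by []. Qed.

Lemma updE A t y : upd A t y t = Some y.
Proof. by rewrite /upd eqxx. Qed.

Lemma upd_neq A t y z : z != t -> upd A t y z = A z.
Proof. by rewrite /upd => /negPf ->. Qed.

Lemma updC A t1 y1 t2 y2 : t1 != t2 ->
  upd (upd A t1 y1) t2 y2 = upd (upd A t2 y2) t1 y1.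
Proof.
move=> t12; apply/funext => z; rewrite /upd.
by case: (eqVneq z t2) => // ->; rewrite eq_sym (negPf t12).
Qed.

Lemma del_upd A t y c : t \notin c -> del (upd A t y) c = upd (del A c) t y.
Proof.
move=> tc; apply/funext => z; rewrite /upd /del.
by case: (eqVneq z t) => // ->; rewrite (negPf tc).
Qed.

Lemma del_nil A : del A [::] = A.
Proof. by apply/funext. Qed.

Lemma delC A c c' : del (del A c) c' = del (del A c') c.
Proof. by apply/funext => z; rewrite /del; case: (z \in c); case: (z \in c'). Qed.

Lemma eq_del A c c' : c =i c' -> del A c = del A c'.
Proof. by move=> cc; apply/funext => z; rewrite /del cc. Qed.

Lemma route_inj A x t t' s s' : A t = None -> A t' = None ->
  path (arrow A) x s -> last x s = t -> path (arrow A) x s' -> last x s' = t' ->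
  s = s'.
Proof.
move=> At At'; elim: s s' x => [|y s IH] [|y' s'] x //=.
- by move=> _ -> /andP[/eqP]; rewrite At.
- by move=> /andP[/eqP + _] _ _ xt; rewrite xt At'.
move=> /andP[/eqP xy ps] ls /andP[/eqP xy' ps'] ls'.
move: xy'; rewrite xy => -[yy']; subst y'.
by congr (_ :: _); apply: IH ps ls ps' ls'.
Qed.

Lemma reach_inj A x t t' : A t = None -> A t' = None ->
  reach A x t -> reach A x t' -> t = t'.
Proof.
move=> At At' [s ps ls] [s' ps' ls'].
by rewrite -ls -ls' (route_inj At At' ps ls ps' ls').
Qed.

Lemma reach0 A x : reach A x x. Proof. by exists [::]. Qed.

Lemma reach_trans A x y z : reach A x y -> reach A y z -> reach A x z.
Proof.
move=> [s ps <-] [s' ps' <-]; exists (s ++ s'); last by rewrite last_cat.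
by rewrite cat_path ps.
Qed.

Lemma reach1 A x y : A x = Some y -> reach A x y.
Proof. by move=> xy; exists [:: y]; rewrite // arrow_cons xy eqxx. Qed.

Lemma reach_cons A x y z : A x = Some y -> reach A y z -> reach A x z.
Proof. by move=> /reach1; apply: reach_trans. Qed.

Lemma reach_path A x s z : path (arrow A) x s -> z \in x :: s ->
  reach A x z /\ reach A z (last x s).
Proof.
elim: s x => [|y s IH] x /=.
  by move=> _; rewrite inE => /eqP ->; split; apply: reach0.
move=> /andP[/eqP xy ps]; rewrite inE => /predU1P[->|zs].
  split; first exact: reach0.
  by exists (y :: s); rewrite // arrow_cons xy eqxx.
have [yz zl] := IH _ ps zs; split => //.
exact: reach_cons xy yz.
Qed.

Lemma reach_ind A (P : V -> Prop) x : P x ->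
  (forall z y, reach A x z -> P z -> A z = Some y -> P y) ->
  forall z, reach A x z -> P z.
Proof.
move=> Px PS z [s + <-]; elim/last_ind: s => //= s y IH.
rewrite rcons_path last_rcons => /andP[ps /eqP].
by apply: PS (IH ps); exists s.
Qed.

Lemma eq_reach A B x : (forall z, reach A x z -> B z = A z) ->
  forall z, reach A x z <-> reach B x z.
Proof.
move=> AB z; split.
  apply: reach_ind; first exact: reach0.
  move=> u y xu Bxu Au; apply: reach_trans Bxu _; apply: reach1.
  by rewrite AB.
apply: reach_ind; first exact: reach0.
move=> u y _ xu; rewrite AB // => Au.
by apply: reach_trans xu _; apply: reach1.
Qed.

Lemma reach_sub A B x z : (forall u y, A u = Some y -> B u = Some y) ->
  reach A x z -> reach B x z.
Proof.
move=> AB; apply: reach_ind; first exact: reach0.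
by move=> u y _ xu /AB /reach1; apply: reach_trans.
Qed.

Lemma chainE A y t s : A t = None -> path (arrow A) y s -> last y s = t ->
  chain A y t = y :: s.
Proof.
move=> At ps ls; rewrite /chain; case: pselect => [h|[]]; last first.
  by exists s; rewrite ps ls eqxx.
case: (cid h) => s' /= /andP[ps' /eqP ls'].
by congr cons; apply: (route_inj At At ps' ls' ps ls).
Qed.

Lemma chain0 A y t : ~ reach A y t -> chain A y t = [::].
Proof.
move=> nr; rewrite /chain; case: pselect => // h.
by case: nr; case: h => s /andP[ps /eqP ls]; exists s.
Qed.

Lemma chainP A y t : A t = None ->
  (exists2 s, path (arrow A) y s /\ last y s = t & chain A y t = y :: s) \/
  (~ reach A y t /\ chain A y t = [::]).
Proof.
move=> At; case: (pselect (reach A y t)) => [[s ps ls]|nr].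
  by left; exists s => //; exact: chainE.
by right; split => //; exact: chain0.
Qed.

Lemma mem_chain A y t z : A t = None -> z \in chain A y t ->
  reach A y z /\ reach A z t.
Proof.
move=> At; case: (chainP y At) => [[s [ps ls] ->]|[_ ->]] // zs.
by have := reach_path ps zs; rewrite ls.
Qed.

Lemma chain_last A y t : A t = None -> reach A y t -> t \in chain A y t.
Proof. by move=> At [s ps ls]; rewrite (chainE At ps ls) -ls mem_last. Qed.

Lemma path_sub A B x s : path (arrow A) x s ->
  (forall z y, z \in belast x s -> A z = Some y -> B z = Some y) ->
  path (arrow B) x s.
Proof.
elim: s x => //= y s IH x => /andP[/eqP xy ps] AB.
apply/andP; split; first by apply/eqP/AB; rewrite ?mem_head.
apply: IH => // z u zs.
by apply: AB; rewrite inE zs orbT.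
Qed.

Lemma chain_sub A B y t : A t = None -> B t = None -> reach A y t ->
  (forall z u, z \in chain A y t -> A z = Some u -> B z = Some u) ->
  chain B y t = chain A y t.
Proof.
move=> At Bt [s ps ls]; rewrite (chainE At ps ls) => AB.
apply: chainE => //; apply: path_sub ps _ => z u zs; apply: AB.
by rewrite lastI mem_rcons inE zs orbT.
Qed.

Definition tip A x : option V :=
  match pselect (exists z, reach A x z /\ A z = None) with
  | left h => Some (projT1 (cid h))
  | right _ => None
  end.

Lemma tipP A x z : tip A x = Some z <-> reach A x z /\ A z = None.
Proof.
rewrite /tip; case: pselect => [h|nh]; last first.
  by split => // h; case: nh; exists z.
case: (cid h) => u /= [xu Au]; split => [[<-]//|[xz Az]].
by rewrite (reach_inj Au Az xu xz).
Qed.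

Lemma tip_None A x : tip A x = None <-> (forall z, reach A x z -> A z != None).
Proof.
split=> [tN z xz|h].
  by apply/negP => /eqP Az; have /tipP : reach A x z /\ A z = None by []; rewrite tN.
by case E : (tip A x) => [z|//]; move/tipP: E => [/h/eqP].
Qed.

Lemma eq_tip A B x : (forall z, reach A x z -> B z = A z) -> tip B x = tip A x.
Proof.
move=> AB; case E : (tip A x) => [z|].
  move/tipP: E => [xz Az]; apply/tipP; split; last by rewrite AB.
  exact/(eq_reach AB).
move/tip_None: E => E; apply/tip_None => z /(eq_reach AB) xz.
by rewrite AB // E.
Qed.

(* The possible effects of revealing the arrow of [t] with value [y]: it is kept, or
   the cycle that it closes is erased. *)
Definition reveals A t y B := B = upd A t y \/ B = del (upd A t y) (chain A y t).

Lemma reveals_undef A t y B t' : A t = None -> t' != t -> A t' = None ->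
  reveals A t y B -> B t' = None.
Proof.
move=> At tt At' [->|->]; first by rewrite upd_neq.
by rewrite /del upd_neq // At'; case: ifP.
Qed.

Lemma reveals_agree A t y B x : A t = None -> ~ reach A x t ->
  reveals A t y B -> forall z, reach A x z -> B z = A z.
Proof.
move=> At xt rB z xz.
have zt : z != t by apply/eqP => zt; apply: xt; rewrite -zt.
case: rB => ->; first by rewrite upd_neq.
rewrite /del upd_neq //; case: ifP => // zc.
by have [_ /(reach_trans xz)] := mem_chain At zc.
Qed.

Lemma reveals_tip A t y B x : A t = None -> tip A x <> Some t ->
  reveals A t y B -> tip B x = tip A x.
Proof.
move=> At xt rB; apply: eq_tip; apply: (reveals_agree At _ rB).
by move=> xrt; apply: xt; apply/tipP.
Qed.

Definition first_tip l A : option V :=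
  foldr (fun x o => if tip A x is Some t then Some t else o) None l.

Lemma first_tip_undef l A t : first_tip l A = Some t -> A t = None.
Proof.
elim: l => //= x l IH; case E : (tip A x) => [z|//] [<-].
by case/tipP: E.
Qed.

Lemma first_tip_None l A :
  first_tip l A = None <-> (forall x, x \in l -> tip A x = None).
Proof.
elim: l => [|x l IH] /=; first by split.
case E : (tip A x) => [z|]; split => //.
- by move=> /(_ x (mem_head _ _)); rewrite E.
- by move=> /IH h y; rewrite inE => /predU1P[->//|/h].
- by move=> h; apply/IH => y yl; apply: h; rewrite inE yl orbT.
Qed.

Lemma reveals_first_tip_None l A t y B : A t = None -> first_tip l A = None ->
  reveals A t y B -> first_tip l B = None.
Proof.
move=> At /first_tip_None lN rB; apply/first_tip_None => x xl.
by rewrite (reveals_tip At _ rB) ?lN.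
Qed.

Lemma reveals_first_tip l A t t' y B : A t = None -> first_tip l A = Some t' ->
  t != t' -> reveals A t y B -> first_tip l B = Some t'.
Proof.
move=> At + tt rB; elim: l => //= x l IH.
case E : (tip A x) => [z|]; last first.
  by move/IH => ->; rewrite (reveals_tip At _ rB) ?E.
case=> zt; rewrite zt in E; rewrite (reveals_tip At _ rB) ?E //.
by case=> /eqP; rewrite eq_sym (negPf tt).
Qed.

Lemma first_tip_cat_done l1 l2 A : first_tip l1 A = None ->
  first_tip (l1 ++ l2) A = first_tip l2 A.
Proof. by elim: l1 => //= x l1 IH; case: (tip A x). Qed.

Lemma first_tip_cat l1 l2 A t : first_tip l1 A = Some t ->
  first_tip (l1 ++ l2) A = Some t.
Proof. by elim: l1 => //= x l1 IH; case: (tip A x). Qed.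

End Arrows.

(** * The abelian property of the revealing process *)

Section Reveal.
Variables (R : realType) (V : countType) (e : rel V) (p : seq V -> R).
Hypothesis hG : infinite_graph e.
Hypothesis hp : cycle_weight e p.
Implicit Types (A B : V -> option V) (s c l : seq V) (x y z t : V).
Implicit Types (f g : (V -> option V) -> R).

Definition nbrs t : seq V := enum_fset (fset_set (neighbours e t)).

Lemma mem_nbrs t y : (y \in nbrs t) = e t y.
Proof.
case: hG => _ _ _ fin _; rewrite /nbrs in_fset_set //.
by apply/idP/idP; rewrite inE.
Qed.

Lemma uniq_nbrs t : uniq (nbrs t). Proof. exact: fset_uniq. Qed.

Lemma size_nbrs t : size (nbrs t) = deg e t. Proof. by []. Qed.

Lemma edge_sym x y : e x y = e y x.
Proof. by case: hG => _ + _ _ _; apply. Qed.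

Lemma deg_gt0 t : (0 < deg e t)%N.
Proof.
case: (hG) => inf _ _ _ con; rewrite -size_nbrs lt0n size_eq0.
apply/negP => /eqP N0; apply: inf.
apply: (@sub_finite_set _ _ [set t]); last exact: finite_set1.
move=> y _ /=; case: (con t y I I) => -[|z s] [/= ps ls _]; first by rewrite ls.
by move: ps; rewrite -mem_nbrs N0.
Qed.

Lemma deg_gt0R t : 0 < (deg e t)%:R :> R. Proof. by rewrite ltr0n deg_gt0. Qed.

Lemma deg_inv_ge0 t : 0 <= (deg e t)%:R^-1 :> R. Proof. by rewrite invr_ge0. Qed.

Local Notation q := (loop_weight e p).

Lemma loop_weight01 c : 0 <= q c <= 1.
Proof. by rewrite /loop_weight; case: ifP => [/hp[]//|_]; rewrite lexx ler01. Qed.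

Lemma loop_weight_nil : q [::] = 0. Proof. by []. Qed.

Lemma is_cycle_rot k c : is_cycle e (rot k c) = is_cycle e c.
Proof. by rewrite /is_cycle size_rot rot_uniq rot_cycle. Qed.

Lemma loop_weight_rot k c : q (rot k c) = q c.
Proof. by rewrite /loop_weight is_cycle_rot; case: ifP => // /hp[]. Qed.

(* If the arrow from [t] to [y] closes no cycle then [c] is [::], which has weight 0. *)
Definition branch f A t y : R :=
  let c := chain A y t in
  q c * f (upd A t y) + (1 - q c) * f (del (upd A t y) c).

Definition reveal t f A : R := (deg e t)%:R^-1 * \sum_(y <- nbrs t) branch f A t y.

Lemma branch_le f g A B t t' y : chain A y t = chain B y t' ->
  f (upd A t y) <= g (upd B t' y) ->
  f (del (upd A t y) (chain A y t)) <= g (del (upd B t' y) (chain A y t)) ->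
  branch f A t y <= branch g B t' y.
Proof.
move=> cc h1 h2; rewrite /branch -cc; have /andP[q0 q1] := loop_weight01 (chain A y t).
by apply: lerD; apply: ler_wpM2l => //; rewrite subr_ge0.
Qed.

Lemma branch_ub f A t y M : (forall B, reveals A t y B -> f B <= M) ->
  branch f A t y <= M.
Proof.
move=> h; have /andP[q0 q1] := loop_weight01 (chain A y t).
have : branch f A t y <=
    q (chain A y t) * M + (1 - q (chain A y t)) * M.
  apply: lerD; apply: ler_wpM2l; rewrite ?subr_ge0 //; apply: h.
    by left.
  by right.
by rewrite -mulrDl addrC subrK mul1r.
Qed.

Lemma branch_lb f A t y M : (forall B, reveals A t y B -> M <= f B) ->
  M <= branch f A t y.
Proof.
move=> h; have /andP[q0 q1] := loop_weight01 (chain A y t).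
have : q (chain A y t) * M + (1 - q (chain A y t)) * M <= branch f A t y.
  apply: lerD; apply: ler_wpM2l; rewrite ?subr_ge0 //; apply: h.
    by left.
  by right.
by rewrite -mulrDl addrC subrK mul1r.
Qed.

Lemma sum_nbrs_const t (M : R) :
  (deg e t)%:R^-1 * \sum_(y <- nbrs t) M = M.
Proof.
rewrite big_const_seq count_predT size_nbrs iter_addr_0 -[M *+ _]mulr_natl.
by rewrite mulKf // gt_eqF // deg_gt0R.
Qed.

Lemma reveal_le t f g A B t' : deg e t = deg e t' -> nbrs t = nbrs t' ->
  (forall y, y \in nbrs t -> branch f A t y <= branch g B t' y) ->
  reveal t f A <= reveal t' g B.
Proof.
move=> dd nn h; rewrite /reveal -dd -nn; apply: (ler_wpM2l (deg_inv_ge0 t)).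
by rewrite big_seq [leRHS]big_seq; apply: ler_sum.
Qed.

Lemma reveal_mono t f g A :
  (forall y B, e t y -> reveals A t y B -> f B <= g B) ->
  reveal t f A <= reveal t g A.
Proof.
move=> h; apply: reveal_le => // y; rewrite mem_nbrs => ty.
by apply: branch_le => //; apply: (h y) => //; [left|right].
Qed.

Lemma reveal_eq t f g A :
  (forall y B, e t y -> reveals A t y B -> f B = g B) ->
  reveal t f A = reveal t g A.
Proof.
by move=> h; apply/eqP; rewrite eq_le !reveal_mono // => y B ty /(h _ _ ty) ->.
Qed.

Lemma reveal_ub t f A M :
  (forall y B, e t y -> reveals A t y B -> f B <= M) -> reveal t f A <= M.
Proof.
move=> h; rewrite -[leRHS](sum_nbrs_const t); apply: (ler_wpM2l (deg_inv_ge0 t)).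
rewrite big_seq [leRHS]big_seq; apply: ler_sum => y; rewrite mem_nbrs => ty.
by apply: branch_ub => B; apply: h.
Qed.

Lemma reveal_lb t f A M :
  (forall y B, e t y -> reveals A t y B -> M <= f B) -> M <= reveal t f A.
Proof.
move=> h; rewrite -[leLHS](sum_nbrs_const t); apply: (ler_wpM2l (deg_inv_ge0 t)).
rewrite big_seq [leRHS]big_seq; apply: ler_sum => y; rewrite mem_nbrs => ty.
by apply: branch_lb => B; apply: h.
Qed.

Lemma reveal_add t f g A :
  reveal t (fun B => f B + g B) A = reveal t f A + reveal t g A.
Proof.
rewrite /reveal -mulrDr -big_split /=; congr (_ * _); apply: eq_bigr => y _.
rewrite /branch; ring.
Qed.

Lemma reveal_scale t k f A : reveal t (fun B => k * f B) A = k * reveal t f A.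
Proof.
rewrite /reveal mulrCA; congr (_ * _); rewrite mulr_sumr; apply: eq_bigr => y _.
rewrite /branch; ring.
Qed.

Lemma chain_upd_same A t1 y1 t2 y2 : A t1 = None -> A t2 = None -> t1 != t2 ->
  reach A y2 t2 -> chain (upd A t1 y1) y2 t2 = chain A y2 t2.
Proof.
move=> At1 At2 t12 r2; apply: chain_sub => //.
  by rewrite upd_neq // eq_sym.
move=> z u zc Az; rewrite upd_neq //.
by apply/eqP => zt; rewrite zt At1 in Az.
Qed.

Lemma reach_upd_None A t1 y1 t2 y2 : A t1 = None -> A t2 = None -> t1 != t2 ->
  ~ reach A y2 t2 -> (reach A y2 t1 -> ~ reach A y1 t2) ->
  ~ reach (upd A t1 y1) y2 t2.
Proof.
move=> At1 At2 t12 n2 n12.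
pose P z := reach A y2 z \/ (reach A y2 t1 /\ reach A y1 z).
suff H : forall z, reach (upd A t1 y1) y2 z -> P z by move=> /H[//|[/n12]].
apply: reach_ind; first by left; exact: reach0.
move=> z y _ Pz; case: (eqVneq z t1) => [zt|zt].
  rewrite zt updE => -[<-]; case: Pz => [|[h _]]; right.
    by rewrite -zt; split => //; exact: reach0.
  by split => //; exact: reach0.
rewrite upd_neq // => /reach1 zy; case: Pz => [h|[h1 h2]]; [left|right].
  exact: reach_trans h zy.
by split => //; exact: reach_trans h2 zy.
Qed.

Lemma chain_upd_cat A t1 y1 t2 y2 : A t1 = None -> A t2 = None -> t1 != t2 ->
  reach A y2 t1 -> reach A y1 t2 ->
  chain (upd A t1 y1) y2 t2 = chain A y2 t1 ++ chain A y1 t2.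
Proof.
move=> At1 At2 t12 [s1 p1 l1] [s2 p2 l2].
rewrite (chainE At1 p1 l1) (chainE At2 p2 l2) cat_cons.
have sub s x : path (arrow A) x s -> path (arrow (upd A t1 y1)) x s.
  move=> ps; apply: path_sub ps _ => z y zs Az; rewrite upd_neq //.
  by apply/eqP => zt; rewrite zt At1 in Az.
apply: chainE; first by rewrite upd_neq // eq_sym.
  by rewrite cat_path sub //= l1 sub // andbT; rewrite /arrow /= updE.
by rewrite last_cat.
Qed.

Lemma branch_nil f A t y : ~ reach A y t -> branch f A t y = f (upd A t y).
Proof.
by move=> nr; rewrite /branch chain0 // del_nil loop_weight_nil mul0r add0r subr0 mul1r.
Qed.

Lemma branch_comm f A t1 t2 y1 y2 : t1 != t2 -> A t1 = None -> A t2 = None ->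
  branch (fun B => branch f B t2 y2) A t1 y1 =
  branch (fun B => branch f B t1 y1) A t2 y2.
Proof.
move=> t12 At1 At2.
have t21 : t2 != t1 by rewrite eq_sym.
(* A cycle closed at [t1] alone contains no arrow at [t2]. *)
have key (u1 u2 z1 z2 : V) : u1 != u2 -> A u1 = None -> A u2 = None ->
    reach A z1 u1 ->
    branch (fun B => branch f B u2 z2) A u1 z1 =
    branch (fun B => branch f B u1 z1) A u2 z2.
  move=> u12 Au1 Au2 r1.
  have u21 : u2 != u1 by rewrite eq_sym.
  have r12 : ~ reach A z1 u2.
    by move=> /(reach_inj Au1 Au2 r1) /eqP; rewrite (negPf u12).
  have u1c : u1 \in chain A z1 u1 by exact: chain_last.
  have u2c : u2 \notin chain A z1 u1.
    apply/negP => /(mem_chain Au1)[_ [[|w s] /= ps ls]].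
      by rewrite ls eqxx in u21.
    by case/andP: ps => /eqP; rewrite Au2.
  have delu : del (upd A u1 z1) (chain A z1 u1) = del A (chain A z1 u1).
    apply/funext => z; rewrite /del; case: ifP => // zc.
    by rewrite upd_neq //; apply/eqP => zu; rewrite zu u1c in zc.
  have chain1 B : B = upd A u2 z2 -> chain B z1 u1 = chain A z1 u1.
    by move=> ->; exact: chain_upd_same.
  case: (pselect (reach A z2 u2)) => r2.
    have disj z : z \in chain A z1 u1 -> z \notin chain A z2 u2.
      move=> /(mem_chain Au1)[_ h1]; apply/negP => /(mem_chain Au2)[_ h2].
      by move/eqP: u12; apply; exact: reach_inj h1 h2.
    have u2c2 : u2 \in chain A z2 u2 by exact: chain_last.
    have delu2 : del (upd A u2 z2) (chain A z2 u2) = del A (chain A z2 u2).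
      apply/funext => z; rewrite /del; case: ifP => // zc.
      by rewrite upd_neq //; apply/eqP => zu; rewrite zu u2c2 in zc.
    have c2 : chain (upd A u1 z1) z2 u2 = chain A z2 u2 by exact: chain_upd_same.
    have c2' : chain (del (upd A u1 z1) (chain A z1 u1)) z2 u2 = chain A z2 u2.
      rewrite delu; apply: chain_sub => //; first by rewrite /del Au2; case: ifP.
      move=> z u zc2; rewrite /del; case: ifP => // /disj.
      by rewrite zc2.
    have c1' : chain (del (upd A u2 z2) (chain A z2 u2)) z1 u1 = chain A z1 u1.
      rewrite delu2; apply: chain_sub => //; first by rewrite /del Au1; case: ifP.
      by move=> z u /disj zc2; rewrite /del (negPf zc2).
    have u1c2 : u1 \notin chain A z2 u2 by exact: disj.
    rewrite /branch c2 (chain1 _ erefl) c2' c1' -!del_upd // (updC _ _ _ u12).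
    by rewrite (delC _ (chain A z2 u2)); ring.
  have n2 : ~ reach (upd A u1 z1) z2 u2 by exact: reach_upd_None.
  have n2' : ~ reach (del (upd A u1 z1) (chain A z1 u1)) z2 u2.
    move=> /(@reach_sub _ _ A) h; apply: r2; apply: h => z y.
    by rewrite delu /del; case: ifP.
  rewrite [RHS](branch_nil _ r2) /branch (chain1 _ erefl) (chain0 n2) (chain0 n2').
  by rewrite !loop_weight_nil !del_nil -!del_upd // (updC _ _ _ u12); ring.
case: (pselect (reach A y1 t1)) => r1; first exact: key.
case: (pselect (reach A y2 t2)) => r2; first by rewrite [RHS]key.
rewrite (branch_nil _ r1) (branch_nil _ r2).
case: (pselect (reach A y2 t1 /\ reach A y1 t2)) => [[r21 r12]|n12]; last first.
  rewrite /= !branch_nil.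
  - by rewrite (updC _ _ _ t12).
  - by apply: reach_upd_None => // r12 r21; apply: n12.
  - by apply: reach_upd_None => // r21 r12; apply: n12.
rewrite /branch !chain_upd_cat // (updC _ _ _ t12).
rewrite -(loop_weight_rot (size (chain A y2 t1))) rot_size_cat.
by congr (_ + _ * f _); apply: eq_del => z; rewrite !mem_cat orbC.
Qed.

Lemma reveal_comm f A t1 t2 : t1 != t2 -> A t1 = None -> A t2 = None ->
  reveal t1 (reveal t2 f) A = reveal t2 (reveal t1 f) A.
Proof.
move=> t12 At1 At2.
have sumb g a (I : seq V) (F : V -> (V -> option V) -> R) B t y :
    g = (fun B => a * \sum_(i <- I) F i B) ->
    branch g B t y = a * \sum_(i <- I) branch (F i) B t y.
  by move=> ->; rewrite /branch big_split /= -!mulr_sumr; ring.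
rewrite /reveal.
under eq_bigr do rewrite (sumb _ _ _ _ _ _ _ erefl).
under [in RHS]eq_bigr do rewrite (sumb _ _ _ _ _ _ _ erefl).
rewrite -!mulr_sumr mulrCA; congr (_ * (_ * _)).
rewrite exchange_big /=; apply: eq_bigr => y2 _; apply: eq_bigr => y1 _.
exact: branch_comm.
Qed.

End Reveal.

Section Run.
Variables (R : realType) (V : countType) (e : rel V) (p : seq V -> R).
Hypothesis hG : infinite_graph e.
Hypothesis hp : cycle_weight e p.
Implicit Types (A B D : V -> option V) (l : seq V) (x y z t : V) (S : set V).
Implicit Types (f g : (V -> option V) -> R).

(* Arrows are revealed at the tip of the first start of [l] that does not lead to a
   cycle yet. The payoff is [g] once all starts do, [1] when the tip leaves [S], and
   [a] if neither has happened after [n] steps. *)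
Fixpoint run l S (a : R) g (n : nat) A : R :=
  if first_tip l A is Some t then
    if t \in S then
      if n is n'.+1 then reveal e p t (run l S a g n') A else a
    else 1
  else g A.

Lemma run_done l S a g n A : first_tip l A = None -> run l S a g n A = g A.
Proof. by case: n => [|n] /= ->. Qed.

Lemma run_out l S a g n A t : first_tip l A = Some t -> t \notin S ->
  run l S a g n A = 1.
Proof. by case: n => [|n] /= -> /negPf ->. Qed.

Lemma run0 l S a g A t : first_tip l A = Some t -> t \in S ->
  run l S a g 0 A = a.
Proof. by move=> /= -> ->. Qed.

Lemma runS l S a g n A t : first_tip l A = Some t -> t \in S ->
  run l S a g n.+1 A = reveal e p t (run l S a g n) A.
Proof. by move=> /= -> ->. Qed.

Lemma run01 l S a g n A : 0 <= a <= 1 -> (forall B, 0 <= g B <= 1) ->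
  0 <= run l S a g n A <= 1.
Proof.
move=> a01 g01; elim: n A => [|n IH] A /=; case E : (first_tip l A) => [t|] //;
  case: ifP; rewrite ?lexx ?ler01 //.
move=> _; apply/andP; split.
  by apply: (reveal_lb hG hp) => y B _ _; case/andP: (IH B).
by apply: (reveal_ub hG hp) => y B _ _; case/andP: (IH B).
Qed.

Lemma run_step_le l S a g n A : (forall B, run l S a g 0 B <= run l S a g 1 B) ->
  run l S a g n A <= run l S a g n.+1 A.
Proof.
move=> h0; elim: n A => // n IH A; case E : (first_tip l A) => [t|]; last first.
  by rewrite !run_done.
case: (boolP (t \in S)) => tS; last by rewrite !(run_out _ _ _ E).
rewrite !(runS _ _ _ E) //; apply: (reveal_mono hG hp) => y B _ _; exact: IH.
Qed.

Lemma run_step_ge l S a g n A : (forall B, run l S a g 1 B <= run l S a g 0 B) ->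
  run l S a g n.+1 A <= run l S a g n A.
Proof.
move=> h0; elim: n A => // n IH A; case E : (first_tip l A) => [t|]; last first.
  by rewrite !run_done.
case: (boolP (t \in S)) => tS; last by rewrite !(run_out _ _ _ E).
rewrite !(runS _ _ _ E) //; apply: (reveal_mono hG hp) => y B _ _; exact: IH.
Qed.

(* The probability that the revealing process from the starts [l] either leaves [S] or
   has not stopped after [n] steps. *)
Definition escape l S n A := run l S 1 (fun=> 0) n A.

(* The expected value of [g] at the end of the revealing process from [l], on the event
   that it stops within [n] steps. *)
Definition val l g n A := run l setT 0 g n A.

(* Picked up by [//] in the side conditions of [run0] and [runS]. *)
Let in_setT' (z : V) : z \in [set: V]. Proof. by rewrite inE. Qed.

Lemma escape01 l S n A : 0 <= escape l S n A <= 1.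
Proof. by apply: run01 => *; rewrite ?lexx ?ler01. Qed.

Lemma val01 l g n A : (forall B, 0 <= g B <= 1) -> 0 <= val l g n A <= 1.
Proof. by move=> g01; apply: run01 => //; rewrite lexx ler01. Qed.

Lemma escape_anti l S m n A : (m <= n)%N -> escape l S n A <= escape l S m A.
Proof.
move=> /subnK <-; elim: (n - m)%N => // k IH; apply: le_trans IH.
apply: run_step_ge => B.
have : run l S 1 (fun=> 0) 1 B <= 1.
  by have /andP[] := escape01 l S 1 B.
case E : (first_tip l B) => [t|]; last by rewrite !run_done.
case: (boolP (t \in S)) => tS; last by rewrite !(run_out _ _ _ E).
by rewrite (run0 _ _ E).
Qed.

Lemma val_mono l g m n A : (forall B, 0 <= g B <= 1) -> (m <= n)%N ->
  val l g m A <= val l g n A.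
Proof.
move=> g01 /subnK <-; elim: (n - m)%N => // k IH; apply: le_trans IH _.
apply: run_step_le => B.
have : 0 <= val l g 1 B by case/andP: (val01 l 1 B g01).
rewrite /val; case E : (first_tip l B) => [t|]; last by rewrite !run_done.
by rewrite (run0 _ _ E).
Qed.

Lemma val_add l g g' n A :
  val l (fun B => g B + g' B) n A = val l g n A + val l g' n A.
Proof.
rewrite /val; elim: n A => [|n IH] A; case E : (first_tip l A) => [t|];
  rewrite ?(run_done _ _ _ _ E) // ?(run0 _ _ E) ?addr0 // !(runS _ _ _ E) //.
rewrite -(reveal_add e p); apply: (reveal_eq hG hp) => y B _ _; exact: IH.
Qed.

Lemma val1 l n A : val l (fun=> 1) n A = 1 - escape l setT n A.
Proof.
rewrite /val /escape; elim: n A => [|n IH] A; case E : (first_tip l A) => [t|];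
  rewrite ?(run_done _ _ _ _ E) ?subr0 // ?(run0 _ _ E) ?subrr // !(runS _ _ _ E) //.
apply/eqP; rewrite eq_sym subr_eq; apply/eqP; rewrite -(reveal_add e p).
apply/esym/eqP; rewrite eq_le; apply/andP; split.
  by apply: (reveal_ub hG hp) => y B _ _; rewrite IH subrK.
by apply: (reveal_lb hG hp) => y B _ _; rewrite IH subrK.
Qed.

Lemma run_eq_starts (P : (V -> option V) -> Prop) l l' S a g n A :
  (forall A t y B, P A -> A t = None -> reveals A t y B -> P B) ->
  (forall A, P A -> first_tip l A = first_tip l' A) -> P A ->
  run l S a g n A = run l' S a g n A.
Proof.
move=> PS Pl; elim: n A => [|n IH] A PA /=; rewrite (Pl _ PA) //.
case E : (first_tip l' A) => [t|] //; case: ifP => // _.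
apply: (reveal_eq hG hp) => y B _ rB; apply: IH; apply: PS rB => //.
exact: first_tip_undef E.
Qed.

Lemma run_cat_done l1 l2 S a g n A : first_tip l1 A = None ->
  run (l1 ++ l2) S a g n A = run l2 S a g n A.
Proof.
apply: (@run_eq_starts (fun A => first_tip l1 A = None)).
  by move=> B t y C l1B Bt; apply: reveals_first_tip_None.
by move=> B; apply: first_tip_cat_done.
Qed.

Lemma run_cons_done x l S a g n A : tip A x = None ->
  run (x :: l) S a g n A = run l S a g n A.
Proof. by move=> xA; apply: (@run_cat_done [:: x]); rewrite /= xA. Qed.

Definition determined l g := forall A B, (forall x, x \in l -> A x = B x) -> g A = g B.

Lemma reveals_determined l g A t y B : determined l g -> A t = None ->
  first_tip l A = None -> reveals A t y B -> g B = g A.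
Proof.
move=> dg At /first_tip_None lN rB; apply: dg => x xl.
apply: (reveals_agree At _ rB); last exact: reach0.
by move=> xt; have /tipP : reach A x t /\ A t = None by []; rewrite lN.
Qed.

(* The abelian property: since reveals at different vertices commute, a reveal that the
   strategy did not ask for costs at most one step. *)
Lemma reveal_val l g n A t : (forall B, 0 <= g B <= 1) -> determined l g ->
  A t = None -> reveal e p t (val l g n) A <= val l g n.+1 A.
Proof.
move=> g01 dg; elim: n A => [|n IH] A At.
  case E : (first_tip l A) => [t'|].
    case: (eqVneq t t') => [tt|tt]; first by rewrite tt /val (runS _ _ _ E).
    apply: (@le_trans _ _ 0); last by case/andP: (val01 l 1 A g01).
    apply: (reveal_ub hG hp) => y B _ rB.
    by rewrite /val (run0 _ _ (reveals_first_tip At E tt rB)).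
  rewrite /val [leRHS](run_done _ _ _ _ E); apply: (reveal_ub hG hp) => y B _ rB.
  by rewrite run_done ?(reveals_determined dg At E rB) // (reveals_first_tip_None At E rB).
case E : (first_tip l A) => [t'|]; last first.
  rewrite /val [leRHS](run_done _ _ _ _ E); apply: (reveal_ub hG hp) => y B _ rB.
  by rewrite run_done ?(reveals_determined dg At E rB) // (reveals_first_tip_None At E rB).
case: (eqVneq t t') => [tt|tt]; first by rewrite tt /val [in leRHS](runS _ _ _ E).
have At' := first_tip_undef E.
rewrite /val [leRHS](runS _ _ _ E) //.
have -> : reveal e p t (run l setT 0 g n.+1) A =
          reveal e p t (reveal e p t' (run l setT 0 g n)) A.
  apply: (reveal_eq hG hp) => y B _ rB.
  by rewrite (runS _ _ _ (reveals_first_tip At E tt rB)).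
rewrite (reveal_comm hp) //; apply: (reveal_mono hG hp) => y B _ rB.
by apply: IH; apply: reveals_undef rB.
Qed.

(* The order of the starts is irrelevant, and starts that do not influence the payoff
   only cost time. *)
Lemma val_sub l l' g n A : (forall B, 0 <= g B <= 1) -> determined l' g ->
  {subset l' <= l} -> val l g n A <= val l' g n A.
Proof.
move=> g01 dg ll; elim: n A => [|n IH] A; case E : (first_tip l A) => [t|].
- by rewrite /val (run0 _ _ E) //; case/andP: (val01 l' 0 A g01).
- rewrite /val !run_done //; apply/first_tip_None => x /ll.
  by move/first_tip_None: E; apply.
- rewrite /val (runS _ _ _ E) //.
  apply: (@le_trans _ _ (reveal e p t (val l' g n) A)).
    by apply: (reveal_mono hG hp) => y B _ _; exact: IH.
  by apply: reveal_val => //; exact: first_tip_undef E.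
- rewrite /val !run_done //; apply/first_tip_None => x /ll.
  by move/first_tip_None: E; apply.
Qed.

Definition join D A : V -> option V := fun z => if D z is Some y then Some y else A z.

Lemma first_tip_trans l D B t (o : option V) : first_tip l D = Some t ->
  (forall x, tip D x = Some t -> tip B x = o) ->
  (forall x, tip D x = None -> tip B x = None) -> o != None ->
  first_tip l B = o.
Proof.
move=> + ht hN oN; elim: l => //= x l IH; case E : (tip D x) => [z|].
  by case=> zt; rewrite zt in E; rewrite (ht _ E); case: o oN {ht IH}.
by move/IH => ->; rewrite (hN _ E).
Qed.

Lemma val_join l g S n D A : (forall B, 0 <= g B <= 1) -> determined l g ->
  (forall z, A z != None -> z \notin S) -> (forall z, D z != None -> z \in S) ->
  val l g n (join D A) <= val l g n D + escape l S n D.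
Proof.
move=> g01 dg AS.
have tipN B x : (forall z, B z != None -> z \in S) -> tip B x = None ->
    tip (join B A) x = None.
  move=> BS /tip_None xN; rewrite (@eq_tip _ B); first exact/tip_None.
  by move=> z /xN; rewrite /join; case: (B z).
elim: n D => [|n IH] D DS; (case E : (first_tip l D) => [t|]; last first).
- rewrite /val /escape !(run_done _ _ _ _ E) addr0 run_done; last first.
    apply/first_tip_None => x xl; apply: tipN => //.
    by move/first_tip_None: E; apply.
  have -> // : g (join D A) = g D.
  apply: dg => x xl; rewrite /join; have /tip_None := (first_tip_None l D).1 E x xl.
  by move=> /(_ x (reach0 _ _)); case: (D x).
- have Dt := first_tip_undef E.
  have [/andP[v0 _] /andP[e0 _]] := (val01 l 0 D g01, escape01 l S 0 D).
  have [/andP[w0 w1]] := val01 l 0 (join D A) g01.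
  case: (boolP (t \in S)) => tS; last first.
    by rewrite /escape (run_out _ _ _ E tS); apply: le_trans w1 _; rewrite lerDr.
  rewrite {1}/val (@run0 _ _ _ _ _ t) ?addr_ge0 //.
  apply: first_tip_trans E _ (fun x => tipN D x DS) _ => // x /tipP[xt _].
  apply/tipP; split.
    by apply: reach_sub xt => u y; rewrite /join => ->.
  rewrite /join Dt; apply/eqP; apply: contraTT tS; exact: AS.
- rewrite /val /escape !(run_done _ _ _ _ E) addr0 run_done; last first.
    apply/first_tip_None => x xl; apply: tipN => //.
    by move/first_tip_None: E; apply.
  have -> // : g (join D A) = g D.
  apply: dg => x xl; rewrite /join; have /tip_None := (first_tip_None l D).1 E x xl.
  by move=> /(_ x (reach0 _ _)); case: (D x).
have Dt := first_tip_undef E.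
have [/andP[v0 _] /andP[e0 _]] := (val01 l n.+1 D g01, escape01 l S n.+1 D).
have [/andP[w0 w1]] := val01 l n.+1 (join D A) g01.
case: (boolP (t \in S)) => tS; last first.
  by rewrite /escape (run_out _ _ _ E tS); apply: le_trans w1 _; rewrite lerDr.
have At : A t = None by apply/eqP; apply: contraTT tS; exact: AS.
have Jt : join D A t = None by rewrite /join Dt.
have EJ : first_tip l (join D A) = Some t.
  apply: first_tip_trans E _ (fun x => tipN D x DS) _ => // x /tipP[xt _].
  apply/tipP; split => //.
  by apply: reach_sub xt => u y; rewrite /join => ->.
rewrite /val /escape !(runS _ _ _ E) // (runS _ _ _ EJ) // -(reveal_add e p).
apply: reveal_le => // y _.
have updS z : upd D t y z != None -> z \in S.
  by case: (eqVneq z t) => [->//|zt]; rewrite upd_neq //; exact: DS.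
have Jupd : upd (join D A) t y = join (upd D t y) A.
  by apply/funext => z; rewrite /upd /join; case: ifP.
case: (pselect (reach D y t)) => ryt.
  have cS z : z \in chain D y t -> z \in S.
    move=> /(mem_chain Dt)[_]; case=> -[|w s] /=; first by move=> _ ->.
    by case/andP=> /eqP Dz _ _; apply: DS; rewrite Dz.
  apply: (branch_le hp).
  - by apply: chain_sub => // z u _; rewrite /join => ->.
  - by rewrite Jupd; exact: IH.
  - have -> : chain (join D A) y t = chain D y t.
      by apply: chain_sub => // z u _; rewrite /join => ->.
    have -> : del (upd (join D A) t y) (chain D y t) =
              join (del (upd D t y) (chain D y t)) A.
      apply/funext => z; rewrite Jupd /del /join; case: ifP => // /cS zS.
      by apply/esym/eqP; apply: contraTT zS; exact: AS.
    apply: IH => z; rewrite /del; case: ifP => // _; exact: updS.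
rewrite [leRHS](branch_nil e p _ ryt).
case: (pselect (reach (join D A) y t)) => rJ; last first.
  by rewrite (branch_nil e p _ rJ) Jupd; exact: IH.
have [z [yz Dz Az]] : exists z, [/\ reach D y z, D z = None & A z != None].
  apply: contra_notP ryt => nz; apply/(eq_reach (B := join D A)) => // z yz.
  rewrite /join; case Dz : (D z) => [//|]; apply/eqP; apply/negPn/negP => Az.
  by apply: nz; exists z.
have zS := AS _ Az.
have zt : z != t by apply/eqP => zt; rewrite zt At in Az.
have subD u w : D u = Some w -> upd D t y u = Some w.
  by move=> Du; rewrite upd_neq //; apply/eqP => ut; rewrite ut Dt in Du.
have Eu : first_tip l (upd D t y) = Some z.
  apply: first_tip_trans E _ _ _ => // x.
    move=> /tipP[xt _]; apply/tipP; split; last by rewrite upd_neq.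
    apply: reach_trans (reach_sub subD xt) _.
    by apply: reach_cons (updE _ _ _) (reach_sub subD yz).
  by move=> xN; rewrite (reveals_tip (y := y) Dt) ?xN //; left.
rewrite [X in _ <= _ + X](run_out _ _ _ Eu zS).
apply: (@le_trans _ _ 1); last by rewrite lerDr; case/andP: (val01 l n (upd D t y) g01).
by apply: (branch_ub hp) => B _; case/andP: (val01 l n B g01).
Qed.

Lemma val_cat_le l1 l2 g1 g2 S k n A : (forall B, 0 <= g1 B <= 1) ->
  (forall B, 0 <= g2 B <= 1) -> determined l1 g1 -> 0 <= k ->
  (forall m B, (m <= n)%N -> (forall z, B z != None -> z \in S) ->
     val l2 g2 m B <= k) ->
  (forall z, A z != None -> z \in S) ->
  val (l1 ++ l2) (fun B => g1 B * g2 B) n A <= k * val l1 g1 n A + escape l1 S n A.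
Proof.
move=> g1p g2p dg1 k0.
have gp B : 0 <= g1 B * g2 B <= 1.
  case/andP: (g1p B) => a b; case/andP: (g2p B) => c d.
  by rewrite mulr_ge0 // mulr_ile1.
have fac m B : first_tip l1 B = None ->
    val l2 (fun B => g1 B * g2 B) m B = g1 B * val l2 g2 m B.
  rewrite /val; elim: m B => [|m IHm] B l1B; case E : (first_tip l2 B) => [t|];
    rewrite ?(run_done _ _ _ _ E) // ?(run0 _ _ E) ?mulr0 // !(runS _ _ _ E) //.
  rewrite -(reveal_scale e p); apply: (reveal_eq hG hp) => y C _ rC.
  have Bt := first_tip_undef E.
  by rewrite IHm ?(reveals_determined dg1 Bt l1B rC) // (reveals_first_tip_None Bt l1B rC).
have doneP m B : first_tip l1 B = None -> val l2 g2 m B <= k ->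
   val (l1 ++ l2) (fun B => g1 B * g2 B) m B <= k * val l1 g1 m B + escape l1 S m B.
  move=> l1B lek; rewrite {1}/val run_cat_done // [run _ _ _ _ _ _]fac //.
  rewrite /val /escape !(run_done _ _ _ _ l1B) addr0 mulrC.
  by apply: ler_wpM2r lek; case/andP: (g1p B).
have outP m B t : first_tip l1 B = Some t -> t \notin S ->
   val (l1 ++ l2) (fun B => g1 B * g2 B) m B <= k * val l1 g1 m B + escape l1 S m B.
  move=> E tS; rewrite /escape (run_out _ _ _ E tS).
  have /andP[_ le1] := val01 (l1 ++ l2) m B gp; apply: le_trans le1 _.
  by rewrite lerDr mulr_ge0 //; case/andP: (val01 l1 m B g1p).
elim: n A => [|n IH] A hk AS; (case E : (first_tip l1 A) => [t|]; last first).
- by apply: doneP => //; apply: hk.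
- case: (boolP (t \in S)) => tS; last exact: outP E tS.
  rewrite {1}/val (run0 _ _ (first_tip_cat _ E)) // addr_ge0 ?mulr_ge0 //.
    by case/andP: (val01 l1 0 A g1p).
  by case/andP: (escape01 l1 S 0 A).
- by apply: doneP => //; apply: hk.
case: (boolP (t \in S)) => tS; last exact: outP E tS.
rewrite /val /escape (runS _ _ _ (first_tip_cat _ E)) // !(runS _ _ _ E) //.
rewrite -(reveal_scale e p) -(reveal_add e p).
apply: (reveal_mono hG hp) => y B _ rB; apply: IH.
  by move=> m C mn; apply: hk; apply: leqW.
have updS z : upd A t y z != None -> z \in S.
  by case: (eqVneq z t) => [->//|zt]; rewrite upd_neq //; exact: AS.
case: rB => -> // z; rewrite /del; case: ifP => // _; exact: updS.
Qed.

End Run.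

(** * One loop-erased walk *)

Section Walk.
Variables (R : realType) (V : countType) (e : rel V) (p : seq V -> R).
Hypothesis hG : infinite_graph e.
Hypothesis hp : cycle_weight e p.
Implicit Types (A B : V -> option V) (s c l : seq V) (x y z t : V) (S W : set V).
Implicit Types (F G : lerw_state V -> R).

Local Notation q := (loop_weight e p).
Local Notation step W s := (lerw_step e p W (Active s)).

Definition live W x s :=
  [/\ s = x :: behead s, uniq s & forall z, z \in s -> z \notin W].

Lemma live_last W x s : live W x s -> last x s \in s.
Proof. by case=> -> _ _; rewrite /= mem_last. Qed.

Lemma live_head W x s : live W x s -> x \in s.
Proof. by case=> -> _ _; exact: mem_head. Qed.

Lemma live1 W x : x \notin W -> live W x [:: x].
Proof. by move=> xW; split => // z; rewrite inE => /eqP ->. Qed.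

Lemma live_lastx W x s y : live W x s -> last y s = last x s.
Proof. by case=> -> _ _. Qed.

Lemma live_size W x s : live W x s -> (0 < size s)%N.
Proof. by case=> -> _ _. Qed.

Lemma last_take_index x s y : y \in s -> last x (take (index y s).+1 s) = y.
Proof.
move=> ys; have ly : (index y s < size s)%N by rewrite index_mem.
rewrite (last_nth x) size_takel // -/(nth _ (take _ _) _).
by rewrite /= nth_take // nth_index.
Qed.

Lemma live_step W x s y u : live W x s ->
  [\/ exists s', [/\ step W s y u = Active s', live W x s' & last x s' = y],
      [/\ y \notin s, y \in W & step W s y u = AtBoundary (rcons s y)] |
      y \in s /\ step W s y u = LoopKept s y].
Proof.
move=> lv; have [sx us sW] := lv; rewrite /=; case: (boolP (y \in s)) => ys /=; last first.
  rewrite /stop_in; case: (boolP (y \in W)) => yW; [by constructor 2|constructor 1].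
  exists (rcons s y); split => //; last by rewrite last_rcons.
  split; first by rewrite sx.
    by rewrite rcons_uniq ys.
  by move=> z; rewrite mem_rcons inE => /predU1P[->//|/sW].
case: ifP => _; first by constructor 3.
rewrite /stop_in (negPf (sW _ ys)); constructor 1.
exists (take (index y s).+1 s); split => //; last exact: last_take_index.
split; first by case: (s) sx => [//|a b [->]].
  exact: take_uniq.
by move=> z /mem_take; apply: sW.
Qed.

(* The uniform variable only matters through its comparison with the weight [q c] of the
   closed loop: the values [q c] and [q c + 1] keep it and erase it respectively. *)
Definition lbranch W F s y : R :=
  let c := drop (index y s) s in
  q c * F (step W s y (q c)) + (1 - q c) * F (step W s y (q c + 1)).

Definition lstep W F x s : R :=
  (deg e (last x s))%:R^-1 * \sum_(y <- nbrs e (last x s)) lbranch W F s y.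

Lemma lstep_mono W W' F G x s :
  (forall y u, e (last x s) y -> F (step W s y u) <= G (step W' s y u)) ->
  lstep W F x s <= lstep W' G x s.
Proof.
move=> h; apply: ler_wpM2l; first by rewrite invr_ge0.
rewrite big_seq [leRHS]big_seq; apply: ler_sum => y; rewrite (mem_nbrs hG) => ty.
have /andP[q0 q1] := loop_weight01 hp (drop (index y s) s).
by apply: lerD; apply: ler_wpM2l; rewrite ?subr_ge0 //; exact: h.
Qed.

Lemma lstep_const W (k : R) x s : lstep W (fun=> k) x s = k.
Proof.
rewrite /lstep -[RHS](sum_nbrs_const hG (last x s)); congr (_ * _).
by apply: eq_bigr => y _; rewrite /lbranch; ring.
Qed.

Lemma lstep_ub W F x s k : (forall y u, e (last x s) y -> F (step W s y u) <= k) ->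
  lstep W F x s <= k.
Proof. by move=> h; rewrite -[leRHS](lstep_const W _ x s); exact: lstep_mono. Qed.

Lemma lstep_lb W F x s k : (forall y u, e (last x s) y -> k <= F (step W s y u)) ->
  k <= lstep W F x s.
Proof. by move=> h; rewrite -[leLHS](lstep_const W _ x s); exact: lstep_mono. Qed.

Lemma lstep_add W F G x s :
  lstep W (fun st => F st + G st) x s = lstep W F x s + lstep W G x s.
Proof.
rewrite /lstep -mulrDr -big_split /=; congr (_ * _); apply: eq_bigr => y _.
rewrite /lbranch; ring.
Qed.

Lemma lstep_scale W k F x s : lstep W (fun st => k * F st) x s = k * lstep W F x s.
Proof.
rewrite /lstep mulrCA; congr (_ * _); rewrite mulr_sumr; apply: eq_bigr => y _.
rewrite /lbranch; ring.
Qed.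

Definition ext A s : V -> option V := fun z =>
  if ((index z s).+1 < size s)%N then Some (nth z s (index z s).+1) else A z.

Definition glue A (st : lerw_state V) : V -> option V :=
  match st with
  | Active s | AtBoundary s => ext A s
  | LoopKept s y => upd (ext A s) (last y s) y
  end.

Definition dom A : set V := [set z | A z != None].

Lemma in_dom A z : (z \in dom A) = (A z != None).
Proof. by apply/idP/idP; rewrite inE. Qed.

Definition closed_arrows A := forall x y, A x = Some y -> A y != None.

Lemma closed_tip A x : closed_arrows A -> A x != None -> tip A x = None.
Proof.
move=> cA Ax; apply/tip_None; apply: reach_ind => // z y _ _; exact: cA.
Qed.

Lemma ext_notin A s z : z \notin s -> ext A s z = A z.
Proof. by move=> zs; rewrite /ext ltnNge ltnW // ltnS leqNgt index_mem. Qed.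

Lemma ext_last A x s : uniq s -> ext A s (last x s) = A (last x s).
Proof.
case: s => [|y s] us //.
by rewrite /ext [last _ _]/= index_last // ltnn.
Qed.

Lemma ext1 A x : ext A [:: x] = A.
Proof. by apply/funext => z; rewrite /ext ltnS. Qed.

Lemma ext_sorted A s : uniq s -> sorted (arrow (ext A s)) s.
Proof.
case: s => // x s us; apply/(sortedP x) => i iS.
rewrite /arrow /= /ext index_uniq // ?(ltnW iS) // iS.
by apply/eqP; congr Some; apply: set_nth_default.
Qed.

Lemma ext_path A x s y : uniq s -> y \in s ->
  [/\ drop (index y s) s = y :: drop (index y s).+1 s,
      path (arrow (ext A s)) y (drop (index y s).+1 s) &
      last y (drop (index y s).+1 s) = last x s].
Proof.
move=> us ys; have ly : (index y s < size s)%N by rewrite index_mem.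
have dE : drop (index y s) s = y :: drop (index y s).+1 s.
  by rewrite (drop_nth y) // nth_index.
split => //.
  have := drop_sorted (index y s) (ext_sorted A us).
  by rewrite dE.
by rewrite -[in RHS](cat_take_drop (index y s) s) last_cat dE.
Qed.

Lemma index_path_last x s : uniq s -> s = x :: behead s ->
  (index (last x s) s).+1 = size s.
Proof.
move=> us sx; move: us; rewrite sx => us.
by rewrite [last _ _]/= index_last.
Qed.

Lemma ext_upd A x s y : live (dom A) x s -> y \notin s ->
  upd (ext A s) (last x s) y = ext A (rcons s y).
Proof.
move=> lv ys; have [_ us _] := lv; apply/funext => z; rewrite /upd /ext size_rcons.
have s0 := live_size lv; case: eqP => [->|/eqP zt].
  have lS : (index (last x s) s).+1 = size s.
    by case: lv => sx {}us _; exact: index_path_last.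
  rewrite -cats1 index_cat (live_last lv).
  by rewrite lS ltnSn nth_cat ltnn subnn.
rewrite -cats1 index_cat; case: (boolP (z \in s)) => zs; last first.
  have iz : (size s <= index z s)%N by rewrite leqNgt index_mem zs.
  by rewrite !ifF //; apply/negbTE; rewrite -leqNgt ?ltnS ?leq_addr // leqW.
have ix : (index z s < size s)%N by rewrite index_mem.
have ix1 : ((index z s).+1 < size s)%N.
  rewrite ltn_neqAle ix andbT; apply/negP => /eqP iz.
  move/eqP: zt; apply; rewrite -(nth_index x zs).
  by rewrite -nth_last -iz.
by rewrite ix1 ltnS ltnW //= nth_cat ix1.
Qed.

Lemma index_take s k z : z \in take k s -> index z (take k s) = index z s.
Proof. by move=> zk; rewrite -[in RHS](cat_take_drop k s) index_cat zk. Qed.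

Lemma ext_del A x s y : live (dom A) x s -> y \in s ->
  del (upd (ext A s) (last x s) y) (drop (index y s) s) =
  ext A (take (index y s).+1 s).
Proof.
move=> lv ys; have [_ us sW] := lv.
have ly : (index y s < size s)%N by rewrite index_mem.
have sN z : z \in s -> A z = None.
  by move=> /sW; rewrite in_dom negbK => /eqP.
have tin : last x s \in drop (index y s) s.
  have [-> _ <-] := ext_path A x us ys; exact: mem_last.
apply/funext => z; rewrite /del; case: ifPn => zd.
  have zs := mem_drop zd.
  have iz : (index y s <= index z s)%N.
    rewrite leqNgt; apply/negP => lz.
    have : z \in take (index y s) s by rewrite in_take.
    by move: us; rewrite -{1}(cat_take_drop (index y s) s) cat_uniq => /and3P[_ /hasPn/(_ _ zd)/negPf ->].
  case: (eqVneq z y) => [->|zy].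
    rewrite /ext size_takel // index_take ?in_take ?ltnS ?leqnn //.
    by rewrite ltnn sN.
  rewrite ext_notin ?sN // in_take // ltnS -ltnNge ltn_neqAle iz andbT.
  by apply: contra zy => /eqP iy; rewrite -[y in z == y](nth_index y ys) iy nth_index.
rewrite upd_neq; last by apply: contra zd => /eqP ->.
case: (boolP (z \in s)) => zs; last first.
  by rewrite !ext_notin //; apply: contra zs => /mem_take.
have iz : (index z s < index y s)%N.
  move: (zs); rewrite -{1}(cat_take_drop (index y s) s) mem_cat (negPf zd) orbF.
  exact: index_ltn.
rewrite /ext size_takel // index_take ?in_take ?ltnS ?(ltnW iz) //.
by rewrite iz (leq_ltn_trans iz ly) nth_take.
Qed.

Lemma chain_ext A x s y : closed_arrows A -> live (dom A) x s ->
  chain (ext A s) y (last x s) = drop (index y s) s.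
Proof.
move=> cA lv; have [_ us sW] := lv.
have Lt := live_last lv.
have AN : A (last x s) = None.
  by move: (sW _ Lt); rewrite in_dom negbK => /eqP.
case: (boolP (y \in s)) => ys.
  have [-> pd ld] := ext_path A x us ys.
  by apply: chainE => //; rewrite ext_last.
rewrite (memNindex ys) drop_size; apply: chain0 => yt.
case Ay : (A y) => [w|]; last first.
  case: yt => -[|z s' /= /andP[/eqP]]; first by move=> _ /= yt; rewrite yt Lt in ys.
  by rewrite ext_notin // Ay.
suff : A (last x s) != None by rewrite AN.
apply: (@reach_ind _ (ext A s) (fun z => A z != None) y _ _ _ yt).
  by rewrite Ay.
move=> z u _ Az; rewrite ext_notin; first exact: cA.
by apply/negP => /sW; rewrite in_dom Az.
Qed.

Lemma reveal_ext A f x s : closed_arrows A -> live (dom A) x s ->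
  reveal e p (last x s) f (ext A s) = lstep (dom A) (f \o glue A) x s.
Proof.
move=> cA lv; have [_ us sW] := lv; congr (_ * _); apply: eq_bigr => y _.
rewrite /branch /lbranch (chain_ext _ cA lv) /=.
have glue_stop s' : glue A (stop_in (dom A) y s') = ext A s'.
  by rewrite /stop_in; case: ifP.
case: (boolP (y \in s)) => ys /=.
  rewrite lexx gerDl ler10 /= glue_stop (ext_del lv ys).
  by rewrite (live_lastx y lv).
by rewrite glue_stop (memNindex ys) drop_size del_nil (ext_upd lv ys); ring.
Qed.

Lemma ext_dom A x s z : uniq s -> s = x :: behead s ->
  (ext A s z != None) = ((z \in s) && (z != last x s)) || (A z != None).
Proof.
move=> us sx; rewrite /ext; case: ifPn => iz.
  rewrite -index_mem (ltnW iz) /=; case: eqP => // zl; move: iz.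
  by rewrite zl (index_path_last us sx) ltnn.
case: (boolP (z \in s)) => zs //=; suff -> : z = last x s by rewrite eqxx.
rewrite -[LHS](nth_index x zs) -nth_last; congr nth.
have zS : (index z s < size s)%N by rewrite index_mem.
by apply/eqP; rewrite eqn_leq; apply/andP; split; lia.
Qed.

Lemma ext_closed A x s : closed_arrows A -> uniq s -> s = x :: behead s ->
  A (last x s) != None -> closed_arrows (ext A s).
Proof.
move=> cA us sx Al z w; rewrite (ext_dom _ _ us sx) {1}/ext; case: ifPn => iz.
  case=> <-; case: eqP => [->|_]; first by rewrite Al orbT.
  by rewrite mem_nth.
by move/cA => ->; rewrite orbT.
Qed.

Lemma glue_boundary A x s y : closed_arrows A -> live (dom A) x s -> y \notin s ->
  y \in dom A ->
  closed_arrows (glue A (AtBoundary (rcons s y))) /\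
  dom (glue A (AtBoundary (rcons s y))) = dom A `|` [set z | z \in rcons s y].
Proof.
move=> cA [sx us sW] ys yA.
have rx : rcons s y = x :: behead (rcons s y) by rewrite sx.
have ru : uniq (rcons s y) by rewrite rcons_uniq ys.
split; first by apply: (ext_closed cA ru rx); rewrite last_rcons -in_dom.
have yA' : A y != None by rewrite -in_dom.
apply/seteqP; split => z; rewrite /dom /= (ext_dom _ _ ru rx) last_rcons mem_rcons inE.
  by case: (eqVneq z y) => [->|_] /=; [left|case/orP; rewrite ?andbT => h; [right|left]].
case: (eqVneq z y) => [->|_] /= hz; [by rewrite yA' ?orbT|rewrite andbT; apply/orP].
by case: hz => h; [right|left].
Qed.

Lemma glue_loop A x s y : closed_arrows A -> live (dom A) x s -> y \in s ->
  closed_arrows (glue A (LoopKept s y)) /\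
  dom (glue A (LoopKept s y)) = dom A `|` [set z | z \in s].
Proof.
move=> cA lv ys; have [sx us sW] := lv.
have dE z : (glue A (LoopKept s y) z != None) = (z \in s) || (A z != None).
  rewrite /= (live_lastx y lv) /upd; case: (eqVneq z (last x s)) => [->|zl].
    by rewrite (live_last lv).
  by rewrite (ext_dom _ _ us sx) zl andbT.
split; last first.
  apply/seteqP; split => z; rewrite /dom /= -/(glue A (LoopKept s y)) dE.
    by case/orP => h; [right|left].
  by case=> h; apply/orP; [right|left].
move=> z w; rewrite dE /= /upd; case: (z == _); first by case=> <-; rewrite ys.
rewrite /ext; case: ifPn => iz; last by move/cA => ->; rewrite orbT.
by case=> <-; rewrite mem_nth.
Qed.

Lemma tip_ext A x s : live (dom A) x s -> tip (ext A s) x = Some (last x s).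
Proof.
move=> lv; have [sx us sW] := lv; apply/tipP; split.
  have [_ pd ld] := ext_path A x us (live_head lv).
  by exists (drop (index x s).+1 s).
rewrite ext_last //; move: (sW _ (live_last lv)); rewrite in_dom negbK.
by move/eqP.
Qed.

Lemma first_tip_ext A x s l : live (dom A) x s ->
  first_tip (x :: l) (ext A s) = Some (last x s).
Proof. by move=> lv; rewrite /= (tip_ext lv). Qed.

(* [escape] for the single loop-erased walk from [x] with boundary [W]. *)
Fixpoint lescape W S x n (st : lerw_state V) : R :=
  if st is Active s then
    if last x s \in S then
      if n is n'.+1 then lstep W (lescape W S x n') x s else 1
    else 1
  else 0.

Lemma lescape01 W S x n st : 0 <= lescape W S x n st <= 1.
Proof.
elim: n st => [|n IH] [s|s|s y] /=; rewrite ?lexx ?ler01 //; case: ifP; rewrite ?ler01 ?lexx //.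
move=> _; apply/andP; split; [apply: lstep_lb|apply: lstep_ub] => y u _;
  by case/andP: (IH (step W s y u)).
Qed.

Lemma escape_ext A x s l S n m (k : R) : 0 <= k ->
  (forall B, closed_arrows B -> escape e p l S m B <= k) ->
  closed_arrows A -> live (dom A) x s ->
  escape e p (x :: l) S (n + m) (ext A s) <= lescape (dom A) S x n (Active s) + k.
Proof.
move=> k0 hk cA; elim: n s => [|n IH] s lv.
  rewrite /= if_same; apply: (@le_trans _ _ 1); last by rewrite lerDl.
  by case/andP: (escape01 hG hp (x :: l) S (0 + m) (ext A s)).
have E := first_tip_ext l lv.
rewrite /=; case: ifPn => tS; last first.
  by rewrite /escape (run_out _ _ _ _ _ E) // lerDl.
rewrite /escape addSn (runS _ _ _ _ _ E) // (reveal_ext _ cA lv).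
rewrite -[X in _ <= _ + X](lstep_const (dom A) k x s) -lstep_add.
apply: lstep_mono => y u _; rewrite [in leLHS]/comp.
have done B : closed_arrows B -> B x != None ->
    run e p (x :: l) S 1 (fun=> 0) (n + m) B <= k.
  move=> cB Bx; rewrite (run_cons_done hG hp) ?closed_tip //.
  by apply: le_trans (hk _ cB); apply: (escape_anti hG hp); rewrite leq_addl.
have lx := live_head lv.
case: (live_step y u lv) => [[s' [-> lv' _]]|[ys yA ->]|[ys ->]].
- exact: IH.
- have [cB dB] := glue_boundary cA lv ys yA.
  rewrite (_ : lescape _ _ _ _ _ = 0) ?add0r; last by case: (n).
  apply: done => //.
  have : dom (glue A (AtBoundary (rcons s y))) x.
    by rewrite dB; right; rewrite /= mem_rcons inE lx orbT.
  by [].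
- have [cB dB] := glue_loop cA lv ys.
  rewrite (_ : lescape _ _ _ _ _ = 0) ?add0r; last by case: (n).
  apply: done => //.
  have : dom (glue A (LoopKept s y)) x by rewrite dB; right.
  by [].
Qed.

Lemma lescape_anti W S S' x n st : (forall z, z \in S -> z \in S') ->
  lescape W S' x n st <= lescape W S x n st.
Proof.
move=> SS; elim: n st => [|n IH] [s|s|s y] //=; first by rewrite !if_same.
case: (boolP (last x s \in S)) => [/SS ->|_].
  by apply: lstep_mono => y u _; exact: IH.
by have /andP[_] := lescape01 W S' x n.+1 (Active s).
Qed.

Lemma escape_starts l S (k : R) : 0 <= k ->
  (forall x, x \in l -> exists n, forall W, x \notin W ->
     lescape W S x n (Active [:: x]) <= k) ->
  exists n, forall A, closed_arrows A -> escape e p l S n A <= (size l)%:R * k.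
Proof.
move=> k0; elim: l => [|x l IH] h.
  by exists 0%N => A _; rewrite mul0r.
have [n hn] := h x (mem_head _ _).
have [m hm] : exists n, forall A, closed_arrows A -> escape e p l S n A <= (size l)%:R * k.
  by apply: IH => y yl; apply: h; rewrite inE yl orbT.
exists (n + m)%N => A cA; rewrite /= -natr1 mulrDl mul1r addrC.
case Ax : (A x) => [w|].
  rewrite /escape (run_cons_done hG hp); last by apply: closed_tip; rewrite ?Ax.
  apply: (@le_trans _ _ (escape e p l S m A)); first by apply: (escape_anti hG hp); rewrite leq_addl.
  by apply: le_trans (hm _ cA) _; rewrite lerDr.
rewrite -[A in escape _ _ _ _ _ A](ext1 _ x).
have lv : live (dom A) x [:: x] by apply: live1; rewrite in_dom Ax.
apply: le_trans (escape_ext _ _ hm cA lv) _; first by rewrite mulr_ge0.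
by rewrite lerD2r hn // in_dom Ax.
Qed.

End Walk.

(** * Exponential decay of the range of a walk *)

Section Decay.
Variables (R : realType) (V : countType) (e : rel V) (p : seq V -> R).
Hypothesis hG : infinite_graph e.
Hypothesis hp : cycle_weight e p.
Implicit Types (s c l : seq V) (x y z t : V) (S W Q : set V).
Implicit Types (F G : lerw_state V -> R).

Local Notation q := (loop_weight e p).
Local Notation step W s := (lerw_step e p W (Active s)).

Local Notation srw := (srw_prob R e).

Fixpoint lstop W x n (st : lerw_state V) : R :=
  if st is Active s then
    if n is n'.+1 then lstep e p W (lstop W x n') x s else 0
  else 1.

Lemma lstop01 W x n st : 0 <= lstop W x n st <= 1.
Proof.
elim: n st => [|n IH] [s|s|s y] /=; rewrite ?lexx ?ler01 //.
by apply/andP; split; [apply: (lstep_lb hG hp)|apply: (lstep_ub hG hp)] => y u _;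
  case/andP: (IH (step W s y u)).
Qed.

Lemma lstop_mono W x m n st : (m <= n)%N -> lstop W x m st <= lstop W x n st.
Proof.
elim: m n st => [|m IH] [|n] [s|s|s y] //= mn.
  by case/andP: (lstop01 W x n.+1 (Active s)).
by apply: (lstep_mono hG hp) => y u _; exact: IH.
Qed.

(* The probability that, within [n] steps, the tip is [k] times in [Q] and the walk has
   not stopped before. *)
Fixpoint lvisit W Q x n k (st : lerw_state V) : R :=
  if st is Active s then
    if k is k'.+1 then
      if n is n'.+1 then
        lstep e p W (lvisit W Q x n' (if last x s \in Q then k' else k)) x s
      else 0
    else 1
  else 0.

Lemma lvisit01 W Q x n k st : 0 <= lvisit W Q x n k st <= 1.
Proof.
elim: n k st => [|n IH] [|k] [s|s|s y] //=; rewrite ?lexx ?ler01 //.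
by apply/andP; split; [apply: (lstep_lb hG hp)|apply: (lstep_ub hG hp)] => y u _;
  case/andP: (IH (if last x s \in Q then k else k.+1) (step W s y u)).
Qed.

Lemma lvisit_anti W Q x n j k st : (j <= k)%N ->
  lvisit W Q x n k st <= lvisit W Q x n j st.
Proof.
move=> jk; elim: n j k jk st => [|n IH] j k jk st.
  by case: st => //= s; case: k jk => [|k]; case: j => [|j] //=; rewrite ?ler01.
case: st => //= s; case: j jk => [|j] jk.
  by case/andP: (lvisit01 W Q x n.+1 k (Active s)).
case: k jk => [//|k] jk.
by apply: (lstep_mono hG hp) => y u _; apply: IH; case: ifP.
Qed.

Lemma live_act W x s y u s' : live W x s -> step W s y u = Active s' ->
  live W x s' /\ last x s' = y.
Proof.
move=> lv; case: (live_step e p y u lv) => [[s1 [-> lv1 l1]] [<-]|[_ _ ->]|[_ ->]] //.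
Qed.

Lemma lvisit_stop W Q x n k j s (K : R) : 0 <= K ->
  (forall n s, live W x s -> lvisit W Q x n k (Active s) <= K) ->
  live W x s ->
  lvisit W Q x n (k + j) (Active s) <= (1 - lstop W x j (Active s)) * K.
Proof.
move=> K0 hK; elim: j n s => [|j IH] n s lv.
  by rewrite addn0 subr0 mul1r; exact: hK.
case: n => [|n].
  rewrite addnS /= mulr_ge0 // subr_ge0.
  by case/andP: (lstop01 W x j.+1 (Active s)).
rewrite addnS /=.
apply: (@le_trans _ _ (lstep e p W (fun st => K + (- K) * lstop W x j st) x s)); last first.
  by rewrite (lstep_add e p W (fun=> K)) (lstep_const p hG) lstep_scale; lra.
apply: (lstep_mono hG hp) => y u _.
apply: (@le_trans _ _ (lvisit W Q x n (k + j) (step W s y u))).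
  by apply: lvisit_anti; case: ifP => _; rewrite ?leqnn ?leqnSn.
case E : (step W s y u) => [s'|s'|s' y'].
- by have [lv' _] := live_act lv E; apply: le_trans (IH n _ lv') _; lra.
- by case: (n) => [|?] /=; case: (j) => [|?] /=; lra.
- by case: (n) => [|?] /=; case: (j) => [|?] /=; lra.
Qed.

Lemma lvisit_decay W Q x (d : R) L n k s : (0 < L)%N -> 0 <= d <= 1 ->
  (forall s, live W x s -> last x s \in Q -> d <= lstop W x L (Active s)) ->
  live W x s -> lvisit W Q x n k (Active s) <= (1 - d) ^+ (k %/ L).
Proof.
move=> L0 /andP[d0 d1] hd lv.
apply: le_trans (lvisit_anti W Q x n (Active s) (leq_trunc_div k L)) _.
elim: (k %/ L)%N n s lv => {k} [|k IH] n s lv.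
  by case/andP: (lvisit01 W Q x n 0 (Active s)).
have pow0 : 0 <= (1 - d) ^+ k by rewrite exprn_ge0 // subr_ge0.
rewrite exprS mulSn addnC; elim: n s lv => [|n IHn] s lv;
  case: (boolP (last x s \in Q)) => sQ.
- apply: le_trans (lvisit_stop 0 L pow0 IH lv) _.
  by apply: ler_wpM2r => //; rewrite lerD2l lerN2 hd.
- by case: (L) L0 => // L' _; rewrite addnS /= mulr_ge0 // subr_ge0.
- apply: le_trans (lvisit_stop n.+1 L pow0 IH lv) _.
  by apply: ler_wpM2r => //; rewrite lerD2l lerN2 hd.
have -> : lvisit W Q x n.+1 (k * L + L) (Active s) =
          lstep e p W (lvisit W Q x n (k * L + L)) x s.
  by case: (L) L0 => // L' _; rewrite addnS /= (negPf sQ).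
apply: (lstep_ub hG hp) => y u _.
case E : (step W s y u) => [s'|s'|s' y'].
- by have [lv' _] := live_act lv E; apply: IHn lv'.
- by case: (n) => [|?]; rewrite /= mulr_ge0 // subr_ge0.
- by case: (n) => [|?]; rewrite /= mulr_ge0 // subr_ge0.
Qed.

Fixpoint lout W S x n (st : lerw_state V) : R :=
  if st is Active s then
    if last x s \in S then
      if n is n'.+1 then lstep e p W (lout W S x n') x s else 0
    else 1
  else 0.

Fixpoint lstay W S x n (st : lerw_state V) : R :=
  if st is Active s then
    if last x s \in S then
      if n is n'.+1 then lstep e p W (lstay W S x n') x s else 1
    else 0
  else 0.

Lemma lescape_split W S x n st :
  lescape e p W S x n st = lout W S x n st + lstay W S x n st.
Proof.
elim: n st => [|n IH] [s|s|s y] /=; rewrite ?addr0 //; case: ifP => _;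
  rewrite ?addr0 ?add0r // -lstep_add.
by congr (_ * _); apply: eq_bigr => y _; rewrite /lbranch !IH.
Qed.

Lemma lstay_visit W S x n st : lstay W S x n st <= lvisit W S x n n st.
Proof.
elim: n st => [|n IH] [s|s|s y] //=.
  by case: ifP; rewrite ?ler01 ?lexx.
case: ifP => sS.
  by apply: (lstep_mono hG hp) => y u _; exact: IH.
by have /andP[] := lvisit01 W S x n.+1 n.+1 (Active s); rewrite /= sS.
Qed.

Lemma lout_le1 W S x n st : lout W S x n st <= 1.
Proof.
elim: n st => [|n IH] [s|s|s y] //=; try case: ifP => _; rewrite ?ler01 ?lexx //.
by apply: (lstep_ub hG hp) => y u _; exact: IH.
Qed.

Lemma lout_visit W S Q x n k s h :
  (forall h, path e x h -> last x h \notin S -> (k <= count [pred z | z \in Q] (belast x h))%N) ->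
  live W x s -> path e x h -> last x h = last x s ->
  lout W S x n (Active s) <=
  lvisit W Q x n (k - count [pred z | z \in Q] (belast x h)) (Active s).
Proof.
move=> hk; elim: n s h => [|n IH] s h lv ph lh; case: (boolP (last x s \in S)) => sS;
  try by rewrite (_ : (k - _)%N = 0%N) /= ?(negPf sS) //; apply/eqP;
    rewrite subn_eq0 hk // lh.
  by rewrite /= sS; case: (_ - _)%N => //=; rewrite ler01.
rewrite /= sS; case E : (k - _)%N => [|j].
  by apply: (lstep_ub hG hp) => y u _; exact: lout_le1.
apply: (lstep_mono hG hp) => y u ty; case F : (step W s y u) => [s'|s'|s' y'];
  try by case: (n) (if _ then _ else _) => [|?] [|?].
have [lv' ly] := live_act lv F.
have -> : (if last x s \in Q then j else j.+1) =
          (k - count [pred z | z \in Q] (belast x (rcons h y)))%N.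
  rewrite belast_rcons lastI -cats1 count_cat subnDA E /= lh addn0.
  by case: (last x s \in Q); rewrite ?subn1 ?subn0.
apply: IH => //; first by rewrite rcons_path ph lh.
by rewrite last_rcons ly.
Qed.

(* An escape either visits [Q] at least [k] times or stays in [S] for [n] steps. *)
Lemma lescape_bound W S Q x (d d' : R) L L' k n :
  (0 < L)%N -> (0 < L')%N -> 0 <= d <= 1 -> 0 <= d' <= 1 ->
  (forall s, live W x s -> last x s \in Q -> d <= lstop W x L (Active s)) ->
  (forall s, live W x s -> last x s \in S -> d' <= lstop W x L' (Active s)) ->
  (forall h, path e x h -> last x h \notin S -> (k <= count [pred z | z \in Q] (belast x h))%N) ->
  x \notin W ->
  lescape e p W S x n (Active [:: x]) <= (1 - d) ^+ (k %/ L) + (1 - d') ^+ (n %/ L').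
Proof.
move=> L0 L'0 d01 d'01 hQ hS hk xW; have lv := live1 xW.
rewrite lescape_split; apply: lerD.
  apply: le_trans (lout_visit n hk lv (h := [::]) _ _) _ => //.
  by rewrite subn0; exact: lvisit_decay.
apply: le_trans (lstay_visit _ _ _ _ _) _; exact: lvisit_decay.
Qed.

Lemma srw_prob01 x s : 0 <= srw x s <= 1.
Proof.
elim: s x => [|y s IH] x /=; first by rewrite ler01 lexx.
case: ifP; rewrite ?lexx ?ler01 // => _; have /andP[s0 s1] := IH y.
have d1 : (deg e x)%:R^-1 <= 1 :> R.
  by rewrite invf_le1 ?ler1n ?(deg_gt0 hG) // ltr0n (deg_gt0 hG).
by rewrite mulr_ge0 ?mulr_ile1 // invr_ge0.
Qed.

Lemma srw_prob_cat x s1 s2 : srw x (s1 ++ s2) = srw x s1 * srw (last x s1) s2.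
Proof.
elim: s1 x => [|y s1 IH] x /=; first by rewrite mul1r.
by case: ifP; rewrite ?mul0r // IH mulrA.
Qed.

Lemma srw_prob_gt0 x s : path e x s -> 0 < srw x s.
Proof.
elim: s x => [|y s IH] x /=; first by rewrite ltr01.
by move=> /andP[-> /IH ps]; rewrite mulr_gt0 // invr_gt0 deg_gt0R.
Qed.

Lemma srw_prob_rcons x s y : srw x (rcons s y) =
  srw x s * (if e (last x s) y then (deg e (last x s))%:R^-1 else 0).
Proof. by rewrite -cats1 srw_prob_cat /=; case: ifP; rewrite ?mulr1. Qed.

Lemma lbranch_le_lstep W F x s y : (forall st, 0 <= F st) -> e (last x s) y ->
  (deg e (last x s))%:R^-1 * lbranch e p W F s y <= lstep e p W F x s.
Proof.
move=> F0 ty; rewrite /lstep; apply: ler_wpM2l; first by rewrite invr_ge0.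
have B0 z : 0 <= lbranch e p W F s z.
  have /andP[q0 q1] := loop_weight01 hp (drop (index z s) s).
  by rewrite /lbranch addr_ge0 // mulr_ge0 // subr_ge0.
rewrite (big_rem y) /=; last by rewrite (mem_nbrs hG).
by rewrite lerDl sumr_ge0.
Qed.

(* [closes a s v] : along the steps [v], the walk with current path [s] that erases all
   its loops closes one of weight at least [a]. *)
Fixpoint closes (a : R) s v : Prop :=
  if v is y :: v' then
    if y \in s then a <= q (drop (index y s) s) \/ closes a (take (index y s).+1 s) v'
    else closes a (rcons s y) v'
  else False.

Lemma lstop_stop W x n s : lstop W x n (AtBoundary s) = 1.
Proof. by case: n. Qed.

Lemma lstop_kept W x n s y : lstop W x n (LoopKept s y) = 1.
Proof. by case: n. Qed.

Lemma closes_stop W x a s v : 0 <= a <= 1 -> live W x s -> closes a s v ->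
  srw (last x s) v * a <= lstop W x (size v) (Active s).
Proof.
move=> /andP[a0 a1]; elim: v s => // y v IH s lv cl.
have nn st : 0 <= lstop W x (size v) st by case/andP: (lstop01 W x (size v) st).
rewrite [srw _ _]/=; case: ifP => ty; last first.
  by rewrite mul0r; case/andP: (lstop01 W x (size (y :: v)) (Active s)).
apply: le_trans (lbranch_le_lstep W nn ty).
rewrite -mulrA; apply: ler_wpM2l; first by rewrite invr_ge0.
have /andP[w0 w1] := srw_prob01 y v.
have le_a : srw y v * a <= a by rewrite ler_piMl.
have le1 : srw y v * a <= 1 by apply: le_trans a1.
move: cl; rewrite /lbranch /=; case: ifPn => ys /= cl; last first.
  rewrite (memNindex ys) drop_size (loop_weight_nil e p) mul0r add0r subr0 mul1r.
  rewrite /stop_in; case: ifPn => yW; first by rewrite lstop_stop.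
  have lv' : live W x (rcons s y).
    have := live_step e p y 0 lv; rewrite /= ys /stop_in (negPf yW).
    by case=> [[s' [[<-]]]|[]|[]].
  by have := IH _ lv' cl; rewrite last_rcons.
have [_ _ sW] := lv.
rewrite lexx gerDl ler10 lstop_kept mulr1 /stop_in (negPf (sW _ ys)).
have /andP[q0 q1] := loop_weight01 hp (drop (index y s) s).
case: cl => [aq|cl].
  by apply: le_trans (le_trans le_a aq) _; rewrite lerDl mulr_ge0 // subr_ge0.
have lv' : live W x (take (index y s).+1 s).
  have := live_step e p y (q (drop (index y s) s) + 1) lv.
  rewrite /= ys /= gerDl ler10 /stop_in (negPf (sW _ ys)).
  by case=> [[s' [[<-]]]|[_]|[_]].
have := IH _ lv' cl; rewrite last_take_index //; set r := lstop _ _ _ _; nra.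
Qed.

Lemma take_index_cat P u r y : y \notin P -> y \in u :: r ->
  take (index y (P ++ u :: r)).+1 (P ++ u :: r) =
  P ++ u :: take (index y (u :: r)) r.
Proof.
move=> yP yr; rewrite index_cat (negPf yP) -addnS take_cat ltnNge leq_addr /=.
by rewrite addKn.
Qed.

(* While the walk follows [b], the part of its path before [u] survives. *)
Lemma closes_to a P u r b v :
  (forall y, y \in rcons b u -> y \notin P) ->
  closes a (P ++ [:: u]) v -> closes a (P ++ u :: r) (b ++ u :: v).
Proof.
elim: b r => [|y b IH] r hP cl.
  have uP := hP _ (mem_head _ _); rewrite /= mem_cat mem_head orbT; right.
  by rewrite take_index_cat ?mem_head //= eqxx take0.
have yP : y \notin P by apply: hP; rewrite rcons_cons mem_head.
have hP' z : z \in rcons b u -> z \notin P.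
  by move=> zb; apply: hP; rewrite rcons_cons inE zb orbT.
rewrite /=; case: ifPn => ys; last by rewrite rcons_cat rcons_cons; exact: IH.
right; rewrite take_index_cat //; first exact: IH.
by move: ys; rewrite mem_cat (negPf yP).
Qed.

Lemma closes_around a P u d1 d2 : a <= q (u :: d1 ++ d2) ->
  uniq (u :: d1 ++ d2) -> (forall y, y \in u :: d1 ++ d2 -> y \notin P) ->
  closes a (P ++ u :: d1) (rcons d2 u).
Proof.
elim: d2 d1 => [|y d2 IH] d1 aq ud hP.
  rewrite /= mem_cat mem_head orbT; left.
  rewrite index_cat (negPf (hP _ (mem_head _ _))) /= eqxx addn0 drop_size_cat //.
  by rewrite cats0 in aq.
have yP : y \notin P by apply: hP; rewrite inE mem_cat mem_head !orbT.
have yd : y \notin u :: d1.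
  move: ud; rewrite -cat_cons cat_uniq => /and3P[_ /hasPn/(_ y) h _].
  by apply: h; rewrite mem_head.
rewrite rcons_cons /= mem_cat (negPf yP) (negPf yd) /= rcons_cat rcons_cons.
by apply: IH; rewrite cat_rcons.
Qed.

(* From any path, following a cycle twice closes it, up to rotation: the vertex of the
   cycle that comes first on the path is visited, and then the cycle is run from there. *)
Lemma closes_cycle a s c : uniq s -> is_cycle e c -> a <= p c ->
  exists b u d, c = b ++ u :: d /\ closes a s (b ++ u :: rcons (d ++ b) u).
Proof.
move=> us cc ac.
have uc : uniq c by case/and3P: cc.
have around P b u d : c = b ++ u :: d -> (forall y, y \in c -> y \notin P) ->
    closes a (P ++ [:: u]) (rcons (d ++ b) u).
  move=> cE cP; have rE : u :: d ++ b = rot (size b) c by rewrite cE rot_size_cat.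
  apply: closes_around; rewrite ?cat0s rE.
  - by rewrite loop_weight_rot // /loop_weight cc.
  - by rewrite rot_uniq.
  - by move=> y; rewrite mem_rot; exact: cP.
case: (boolP (has (mem c) s)) => hs; last first.
  case: c cc ac uc hs around => [//|u d] cc ac uc hs around.
  have cs y : y \in u :: d -> y \notin s.
    by move=> yc; apply/negP => ys; case/hasP: hs; exists y.
  exists [::], u, d; split => //=; rewrite (negPf (cs _ (mem_head _ _))) -cats1.
  exact: (around s [::]).
case: (split_find hs) us => u P r /= uc' nP us.
have cP y : y \in c -> y \notin P.
  by move=> yc; apply/negP => yP; case/hasP: nP; exists y.
have [b [d cE]] : exists b d, c = b ++ u :: d.
  by case/splitPr: uc' => b d; exists b, d.
exists b, u, d; split => //.
rewrite cat_rcons; apply: closes_to; last exact: around.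
by move=> y yb; apply: cP; rewrite cE -cat_rcons mem_cat yb.
Qed.

End Decay.

Section Trial.
Variables (R : realType) (V : countType) (e : rel V) (p : seq V -> R).
Hypothesis hG : infinite_graph e.
Hypothesis hp : cycle_weight e p.
Implicit Types (s c l : seq V) (x y z t u : V) (S W Q : set V).

Local Notation srw := (srw_prob R e).
Local Notation lstop := (lstop e p).

Definition good (a b : R) : set V :=
  [set v | exists c, [/\ is_cycle e c, a <= p c & b < srw v (rcons c (head v c))]].

Lemma srw_prob_catl x s1 s2 : srw x (s1 ++ s2) <= srw x s1.
Proof.
rewrite srw_prob_cat; have /andP[? ?] := srw_prob01 R hG x s1.
have /andP[? ?] := srw_prob01 R hG (last x s1) s2; exact: ler_piMr.
Qed.

Lemma srw_prob_catr x s1 s2 : srw x (s1 ++ s2) <= srw (last x s1) s2.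
Proof.
rewrite srw_prob_cat; have /andP[? ?] := srw_prob01 R hG x s1.
have /andP[? ?] := srw_prob01 R hG (last x s1) s2; exact: ler_piMl.
Qed.

Lemma deg_cycle c z : is_cycle e c -> z \in c -> (2 <= deg e z)%N.
Proof.
move=> cc zc; case: (rot_to zc) => i c' rc.
have : is_cycle e (z :: c') by rewrite -rc is_cycle_rot.
case: c' {rc} => [|y c']; first by rewrite /is_cycle.
case/lastP: c' => [|c' w]; first by rewrite /is_cycle.
case/and3P=> _ uc; rewrite /= rcons_path last_rcons => /and3P[zy _ wz].
have yw : y != w.
  move: uc => /= /and3P[_ + _]; rewrite mem_rcons inE negb_or; by case/andP.
rewrite -size_nbrs; apply: (@uniq_leq_size _ [:: y; w]); first by rewrite /= inE yw.
move=> t; rewrite !inE => /orP[]/eqP ->; rewrite (mem_nbrs hG) //.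
by rewrite (edge_sym hG).
Qed.

Lemma srw_prob_half x s : (forall z, z \in belast x s -> (2 <= deg e z)%N) ->
  srw x s <= 2^-1 ^+ size s.
Proof.
elim: s x => [|y s IH] x hd; first by rewrite expr0.
have pow0 : 0 <= 2^-1 ^+ (size s).+1 :> R by rewrite exprn_ge0 // invr_ge0.
have d2 := hd x (mem_head _ _).
have dle : (deg e x)%:R^-1 <= 2^-1 :> R.
  by rewrite lef_pV2 ?posrE ?ltr0n ?ler_nat //; exact: leq_trans d2.
have sle : srw y s <= 2^-1 ^+ size s.
  by apply: IH => z zs; apply: hd; rewrite inE zs orbT.
rewrite [srw _ _]/=; case: ifP => _ //=; rewrite exprS; apply: ler_pM => //.
by case/andP: (srw_prob01 R hG y s).
Qed.

Lemma srw_cycle_half (v : V) c : is_cycle e c ->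
  srw v (rcons c (head v c)) <= 2^-1 ^+ size c.
Proof.
case: c => // h c cc; apply: (le_trans (srw_prob_catr v [:: h] (rcons c h))).
rewrite -[size (h :: c)]/(size c).+1 -(size_rcons c h); apply: srw_prob_half => z; rewrite belast_rcons.
exact: deg_cycle.
Qed.

Lemma expr_lt (t b : R) : 0 <= t < 1 -> 0 < b -> exists k, forall n, (k <= n)%N -> t ^+ n < b.
Proof.
move=> /andP[t0 t1] b0; have /cvgrPdist_lt/(_ b b0) : (t ^+ n @[n --> \oo] --> 0).
  by apply: cvg_expr; rewrite ger0_norm.
case=> k _ hk; exists k => n kn; have := hk n kn.
by rewrite /= sub0r normrN ger0_norm // exprn_ge0.
Qed.

Lemma srw_cycle_twice (b : R) (v : V) B u D : 0 <= b ->
  b < srw v (rcons (B ++ u :: D) (head v (B ++ u :: D))) ->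
  b ^+ 2 <= srw v (B ++ u :: rcons (D ++ B) u).
Proof.
move=> b0; case: B => [|h B]; rewrite ?cat0s ?cat_cons [head _ _]/= => hb.
  have /andP[_ w1] := srw_prob01 R hG v (u :: rcons D u).
  rewrite cats0; apply: le_trans (ltW hb); rewrite expr2; apply: ler_piMl => //.
  exact: le_trans (ltW hb) w1.
have -> : h :: B ++ u :: rcons (D ++ h :: B) u =
    rcons (h :: B ++ u :: D) h ++ rcons B u.
  by rewrite -!cats1 /= -?catA /= -?catA /= -?catA.
rewrite srw_prob_cat expr2; apply: ler_pM => //; first exact: ltW.
rewrite last_rcons; apply: le_trans (ltW hb) _.
have -> : rcons (h :: B ++ u :: D) h = [:: h] ++ (rcons B u ++ rcons D h).
  by rewrite -!cats1 /= -?catA /= -?catA /=.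
by apply: le_trans (srw_prob_catr _ _ _) _; exact: srw_prob_catl.
Qed.

Lemma good_stop (a b : R) : 0 <= a <= 1 -> 0 < b ->
  exists2 L, (0 < L)%N & forall W x s, live W x s -> last x s \in good a b ->
    a * b ^+ 2 <= lstop W x L (Active s).
Proof.
move=> a01 b0; have [K hK] : exists k, forall n, (k <= n)%N -> 2^-1 ^+ n < b :> R.
  by apply: expr_lt => //; lra.
exists (K + K).+1 => // W x s lv; rewrite inE => -[c [cc ac bc]].
have [_ us _] := lv.
have [B [u [D [cE cl]]]] := closes_cycle hp us cc ac.
have cK : (size c < K)%N.
  rewrite ltnNge; apply/negP => /hK cb.
  by have := lt_trans bc (le_lt_trans (srw_cycle_half _ cc) cb); rewrite ltxx.
rewrite cE in bc cK.
apply: (@le_trans _ _ (lstop W x (size (B ++ u :: rcons (D ++ B) u)) (Active s))).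
  apply: le_trans (closes_stop hG hp a01 lv cl); rewrite mulrC.
  apply: ler_wpM2r; first by case/andP: a01.
  exact: (srw_cycle_twice (ltW b0) bc).
apply: (lstop_mono hG hp); move: cK; rewrite !size_cat /= size_rcons size_cat; lia.
Qed.

Lemma lstop_path W Q x L (d : R) s (v : seq V) : 0 <= d <= 1 ->
  (forall s, live W x s -> last x s \in Q -> d <= lstop W x L (Active s)) ->
  live W x s -> path e (last x s) v -> last (last x s) v \in Q ->
  srw (last x s) v * d <= lstop W x (size v + L) (Active s).
Proof.
move=> /andP[d0 d1] hd; elim: v s => [|y v IH] s lv; first by move=> *; rewrite mul1r hd.
have nn st : 0 <= lstop W x (size v + L) st by case/andP: (lstop01 hG hp W x (size v + L) st).
rewrite [path _ _ _]/= => /andP[ty pv] lQ; rewrite [srw _ _]/= ty addSn.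
apply: le_trans (lbranch_le_lstep hG hp W nn ty).
rewrite -mulrA; apply: ler_wpM2l; first by rewrite invr_ge0.
have /andP[w0 w1] := srw_prob01 R hG y v.
have le1 : srw y v * d <= 1 by apply: mulr_ile1.
have key k : srw y v * d <= lstop W x (size v + L) (lerw_step e p W (Active s) y k).
  case: (live_step e p y k lv) => [[s' [-> lv' ls']]|[_ _ ->]|[_ ->]].
  - by have := IH _ lv'; rewrite ls'; apply.
  - by rewrite lstop_stop.
  - by rewrite lstop_kept.
have /andP[q0 q1] := loop_weight01 hp (drop (index y s) s).
rewrite /lbranch; have := key (loop_weight e p (drop (index y s) s)).
have := key (loop_weight e p (drop (index y s) s) + 1).
by set r1 := lstop _ _ _ _; set r2 := lstop _ _ _ _; nra.
Qed.

Lemma stop_finite Q S L (d : R) : 0 < d <= 1 -> finite_set S -> Q !=set0 ->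
  (forall W x s, live W x s -> last x s \in Q -> d <= lstop W x L (Active s)) ->
  exists L' (d' : R), [/\ (0 < L')%N, 0 < d' <= 1 & forall W x s, live W x s ->
    last x s \in S -> d' <= lstop W x L' (Active s)].
Proof.
move=> /andP[d0 d1] /finite_seqP[l Sl] [w Qw] hd.
have [N [r [r0 r1 hr]]] : exists N (r : R), [/\ 0 < r, r <= 1 &
    forall z, z \in l -> exists v, [/\ path e z v, last z v \in Q,
      (size v <= N)%N & r <= srw z v]].
  elim: (l) => [|z l' [N [r [r0 r1 hr]]]]; first by exists 0%N, 1.
  have [v [pv lv _]] : exists v, [/\ path e z v, last z v = w & forall y, y \in v -> setT y].
    by case: hG => _ _ _ _ con; apply: con.
  exists (maxn N (size v)), (Num.min r (srw z v)); split.
  - by rewrite lt_min r0 srw_prob_gt0.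
  - by rewrite ge_min r1.
  - move=> y; rewrite inE => /predU1P[->|/hr[v' [pv' lv' sv' rv']]].
      exists v; rewrite lv mem_set // leq_maxr ge_min lexx orbT; split => //.
    by exists v'; split; rewrite // ?leq_max ?sv' // ge_min rv'.
exists (N + L).+1, (r * d); split => //; first by rewrite mulr_gt0 //= mulr_ile1 // ltW.
move=> W x s lv; rewrite inE Sl => /hr[v [pv lQ sv rv]].
apply: (@le_trans _ _ (lstop W x (size v + L) (Active s))); last first.
  by apply: (lstop_mono hG hp); rewrite leqW // leq_add2r.
apply: le_trans (lstop_path (d := d) _ (hd W x) lv pv lQ); last by rewrite ltW.
by apply: ler_wpM2r => //; exact: ltW.
Qed.

End Trial.

Section Distance.
Variables (V : countType) (e : rel V).
Hypothesis hG : infinite_graph e.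
Implicit Types (s h : seq V) (x y z u w : V) (P S : set V).

Lemma connected_path x y : exists2 s, path e x s & last x s = y.
Proof.
by case: hG => _ _ _ _ con; case: (con x y I I) => s [ps ls _]; exists s.
Qed.

Lemma gdist_walk x y : walk_of_length e x y (gdist e x y).
Proof.
rewrite /gdist; case: pselect => [h|[]].
  by case: ex_minnP => m /asboolP.
have [s ps ls] := connected_path x y.
by exists (size s); apply/asboolP; exists s.
Qed.

Lemma gdist_le x y s : path e x s -> last x s = y -> (gdist e x y <= size s)%N.
Proof.
move=> ps ls; rewrite /gdist; case: pselect => // h.
by case: ex_minnP => m _; apply; apply/asboolP; exists s.
Qed.

Lemma gdist0 x : gdist e x x = 0%N.
Proof. by apply/eqP; rewrite -leqn0; exact: (@gdist_le x x [::]). Qed.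

Lemma gdist_triangle y x z : (gdist e x z <= gdist e x y + gdist e y z)%N.
Proof.
have [s [ps ls <-]] := gdist_walk x y; have [s' [ps' ls' <-]] := gdist_walk y z.
rewrite -size_cat; apply: gdist_le; last by rewrite last_cat ls.
by rewrite cat_path ps ls.
Qed.

Lemma path_rev x s : path e x s ->
  path e (last x s) (rev (belast x s)) /\ last (last x s) (rev (belast x s)) = x.
Proof.
move=> ps; split; last by case: s ps => //= y s _; rewrite rev_cons last_rcons.
by rewrite rev_path (eq_path (e' := e)) // => u w; exact: (edge_sym hG).
Qed.

Lemma gdist_sym x y : gdist e x y = gdist e y x.
Proof.
have le u w : (gdist e u w <= gdist e w u)%N.
  have [s [ps ls <-]] := gdist_walk w u; have [] := path_rev ps; rewrite ls => pr lr.
  by apply: leq_trans (gdist_le pr lr) _; rewrite size_rev size_belast.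
by apply/eqP; rewrite eqn_leq !le.
Qed.

Lemma path_exit P x s : path e x s -> P x -> ~ P (last x s) ->
  exists2 u, u \in belast x s & vboundary e P u.
Proof.
elim: s x => [|y s IH] x /=; first by move=> _ Px /(_ Px).
move=> /andP[xy ps] Px nP; case: (pselect (P y)) => Py.
  by have [u us bu] := IH y ps Py nP; exists u => //; rewrite inE us orbT.
by exists x; [rewrite mem_head|split => //; exists y].
Qed.

Lemma gdist_path x s z : path e x s -> size s = gdist e x (last x s) ->
  z \in x :: s -> (gdist e x z <= size s)%N.
Proof.
move=> ps _ /(nthP x)[i]; rewrite /= ltnS => iS <-.
apply: (@leq_trans (size (take i s))); last by rewrite size_take; case: ltnP.
apply: gdist_le; first by move: ps; rewrite -{1}(cat_take_drop i s) cat_path => /andP[].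
by rewrite (last_nth x) size_takel //; case: (i) => //= j; rewrite nth_take.
Qed.

Lemma finite_walk x k : finite_set [set z | walk_of_length e x z k].
Proof.
elim: k x => [|k IH] x.
  apply: (@sub_finite_set _ _ [set x]); last exact: finite_set1.
  by move=> z [s [_ <- /size0nil ->]].
apply: (@sub_finite_set _ _ (\bigcup_(y in neighbours e x)
    [set z | walk_of_length e y z k])).
  move=> z [[|y s] [//= /andP[xy ps] ls [sk]]].
  by exists y => //; exists s.
by apply: bigcup_finite => //; case: hG.
Qed.

Lemma finite_ball x r : finite_set [set z | (gdist e x z < r)%N].
Proof.
apply: (@sub_finite_set _ _ (\bigcup_(k in `I_r) [set z | walk_of_length e x z k])).
  by move=> z /= zr; exists (gdist e x z) => //; exact: gdist_walk.
by apply: bigcup_finite => // k _; exact: finite_walk.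
Qed.

Lemma boundary_neq0 P x : finite_set P -> P x -> exists u, vboundary e P u.
Proof.
move=> fP Px; have [w nw] : exists w, ~ P w.
  apply: contrapT => nw; case: (hG) => inf _ _ _ _; apply: inf.
  by apply: (@sub_finite_set _ _ P) => // w _; apply: contrapT => nPw; apply: nw; exists w.
have [s ps ls] := connected_path x w; rewrite -ls in nw.
by have [u _ bu] := path_exit ps Px nw; exists u.
Qed.

(* The sets [B x n] need not lie in a ball around [x]: they may swallow long dead ends of
   the graph. So a walk from [x] to a distant [z] need not leave [B x n], but otherwise
   it has to enter [B z n]. *)
Lemma not_mutually_inside P P' x z d : finite_set P -> finite_set P' ->
  P x -> P' z -> (forall u, vboundary e P u -> (gdist e x u <= d)%N) ->
  (forall u, vboundary e P' u -> (gdist e z u <= d)%N) ->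
  (d + d < gdist e x z)%N -> ~ P z \/ ~ P' x.
Proof.
move=> fP fP' Px P'z bP bP' dxz; apply/not_andP => -[Pz P'x].
have wl Q Q' y y' u : Q y -> Q' y' -> Q' y ->
    (forall u, vboundary e Q u -> (gdist e y u <= d)%N) ->
    (forall u, vboundary e Q' u -> (gdist e y' u <= d)%N) ->
    (d + d < gdist e y y')%N ->
    vboundary e (Q `|` Q') u -> Q u -> False.
  move=> Qy Q'y' Q'y bQ bQ' dd [_ [w uw nw]] Qu.
  have ub : vboundary e Q u by split => //; exists w => // Qw; apply: nw; left.
  have close v : (gdist e y v <= d)%N -> vboundary e Q' v -> False.
    move=> yv /bQ'; have := gdist_triangle v y y'; rewrite (gdist_sym v y'); lia.
  case: (pselect (Q' u)) => Q'u.
    apply: (close u (bQ u ub)); split => //; exists w => // Q'w; apply: nw; right.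
    exact: Q'w.
  have [s [ps ls sz]] := gdist_walk y u; rewrite -ls in Q'u sz.
  have [v vs bv] := path_exit ps Q'y Q'u; apply: (close v) => //.
  apply: leq_trans (gdist_path ps sz _) _.
    by rewrite lastI mem_rcons inE vs orbT.
  by rewrite sz ls; exact: bQ.
have [u bu] : exists u, vboundary e (P `|` P') u.
  by apply: (@boundary_neq0 _ x); [rewrite finite_setU|left].
case: (bu) => -[Pu|P'u] _; first exact: (wl P P' x z u).
apply: (wl P' P z x u) => //; first by rewrite gdist_sym.
by rewrite setUC.
Qed.

End Distance.

Section EscapeDecay.
Variables (R : realType) (V : countType) (e : rel V) (p : seq V -> R).
Hypothesis hG : infinite_graph e.
Hypothesis hp : cycle_weight e p.
Implicit Types (s h l : seq V) (x y z u : V) (P S Q : set V).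

Lemma nested_boundaries Q (B : nat -> set V) l n D :
  (forall j, (0 < j)%N -> B j `<=` B j.+1) ->
  (forall j u, (0 < j)%N -> vboundary e (B j) u ->
     u \in Q /\ exists y, [/\ e u y, B j.+1 y & ~ B j y]) ->
  (forall u, u \in Q -> (deg e u <= D)%N) ->
  (forall j, (0 < j <= n)%N -> exists2 u, u \in l & vboundary e (B j) u) ->
  (n <= D * count [pred z | z \in Q] l)%N.
Proof.
move=> mono hB hD hl; case: n hl => // n hl.
have [u0 _ _] := hl 1%N isT.
have /choice[F hF] : forall j, exists F : V * V, (0 < j <= n.+1)%N ->
    [/\ F.1 \in l, F.1 \in Q, e F.1 F.2, B j.+1 F.2 & ~ B j F.2].
  move=> j.
  case: (boolP (0 < j <= n.+1)%N) => jn; last by exists (u0, u0).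
  have [u ul bu] := hl j jn; have /andP[j0 _] := jn.
  by have [uQ [y [uy By nBy]]] := hB j u j0 bu; exists (u, y).
have mono' i j : (0 < i)%N -> (i <= j)%N -> B i `<=` B j.
  move=> i0; elim: j => [|j IH]; first by case: i i0.
  rewrite leq_eqVlt => /predU1P[<-//|]; rewrite ltnS => ij z /(IH ij).
  by apply: mono; exact: leq_trans ij.
have inj : {in iota 1 n.+1 &, injective F}.
  have lt i j : (0 < i)%N -> (i < j <= n.+1)%N -> F i = F j -> False.
    move=> i0 /andP[ij jn] Fij.
    have [|_ _ _ Bi _] := hF i; first by rewrite i0; apply: ltnW (leq_trans ij jn).
    have [|_ _ _ _] := hF j; first by rewrite jn andbT; exact: leq_trans ij.
    by apply; rewrite -Fij; apply: mono' Bi.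
  move=> i j; rewrite !mem_iota !add1n !ltnS => /andP[i0 iN] /andP[j0 jN] Fij.
  by case: (ltngtP i j) => // ij; [case: (lt i j)|case: (lt j i)] => //; rewrite ij.
set prs := [seq (u, y) | u <- [seq z <- l | z \in Q], y <- nbrs e u].
apply: (@leq_trans (size prs)).
  rewrite -[n.+1 in leqLHS](size_iota 1) -(size_map F); apply: uniq_leq_size.
    by rewrite map_inj_in_uniq ?iota_uniq.
  move=> _ /mapP[j + ->]; rewrite mem_iota add1n ltnS => /hF[Fl FQ Fe _ _].
  apply/allpairsPdep; exists (F j).1, (F j).2; split; last by case: (F j).
    by rewrite mem_filter Fl andbT.
  by rewrite (mem_nbrs hG).
rewrite size_allpairs_dep -size_filter; elim: l {hl prs hF} => //= u l IH.
case: (boolP (u \in Q)) => //= uQ.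
by rewrite mulnS; apply: leq_add => //; rewrite size_nbrs hD.
Qed.

Lemma deg_good (a b : R) u D : 0 < b -> b^-1 <= D%:R -> u \in good e p a b ->
  (deg e u <= D)%N.
Proof.
move=> b0 bD; rewrite inE => -[[|h c] [// _ _]].
rewrite rcons_cons [head _ _]/= => bs.
have bd : b < (deg e u)%:R^-1.
  apply: lt_le_trans bs _; rewrite [srw_prob _ _ _ _]/=; case: ifP => _.
    apply: ler_piMr; first by rewrite invr_ge0.
    by case/andP: (srw_prob01 R hG h (rcons c h)).
  by rewrite invr_ge0.
rewrite -(ler_nat R); apply: le_trans bD.
by rewrite -[leLHS]invrK lef_pV2 ?posrE ?invr_gt0 ?deg_gt0R //; exact: ltW.
Qed.

Lemma lescape_decay : uniform_loop e p ->
  exists (t : R) (N : nat), [/\ 0 <= t < 1, (0 < N)%N &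
    forall x r (k : R), 0 < k -> exists n, forall W, x \notin W ->
      lescape e p W [set z | (gdist e x z < r)%N] x n (Active [:: x])
        <= t ^+ (r.-1 %/ N) + k].
Proof.
case=> al [b [M [M' [C [d [Gam [B [[al0 b0 M0 M'0 C0] hGam hB hcyc hdist]]]]]]]].
pose a := Num.min al 1.
have a01 : 0 < a <= 1 by rewrite /a lt_min al0 ltr01 /= ge_min lexx orbT.
have bgood x n u : (0 < n)%N -> vboundary e (B x n) u ->
    u \in good e p a b /\ exists y, [/\ e u y, B x n.+1 y & ~ B x n y].
  move=> n0 bu; have [c [Gc cB bc]] := hcyc x n u n0 bu.
  have [cc /andP[ac _]] := hGam c Gc; split.
    rewrite inE; exists c; split => //.
    by apply: le_trans ac; rewrite /a ge_min lexx.
  case: c cc bc cB {Gc ac} => [|y c] // _ bc cB; exists y.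
  have [B1 B2] := cB y (mem_head _ _); split => //; last by move=> By; apply: B2; left.
  by move: bc; rewrite /=; case: ifP => // _; rewrite ltNge (ltW b0).
have [x0 _] : exists x : V, True.
  apply: contrapT => nx; case: (hG) => inf _ _ _ _; apply: inf.
  apply: (@sub_finite_set _ _ set0) => // x _; by case: nx; exists x.
have [u0 bu0] : exists u, vboundary e (B x0 1) u.
  have [h _ _] := hB x0; have [fB _ Bx] := h 1%N isT.
  exact: (boundary_neq0 hG fB Bx).
have [u0good _] := bgood x0 1%N u0 isT bu0.
have b1 : b <= 1.
  move: (u0good); rewrite inE => -[c [_ _ /ltW bc]]; apply: le_trans bc _.
  by case/andP: (srw_prob01 R hG u0 (rcons c (head u0 c))).
pose dl := a * b ^+ 2.
have dl01 : 0 < dl <= 1.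
  case/andP: a01 => a0 a1; rewrite /dl mulr_gt0 ?exprn_gt0 //=.
  by rewrite mulr_ile1 ?exprn_ge0 ?exprn_ile1 // ltW.
have [L L0 hL] : exists2 L, (0 < L)%N & forall W x s, live W x s ->
    last x s \in good e p a b -> dl <= lstop e p W x L (Active s).
  by apply: (good_stop hG hp _ b0); case/andP: a01 => /ltW -> ->.
have natub (r : R) : exists m : nat, r <= m%:R.
  by exists (Num.bound `|r|); apply: le_trans (ler_norm _) (ltW (archi_boundP (normr_ge0 _))).
have [D bD] := natub b^-1.
have [M1 MM1] := natub M.
have D0 : (0 < D)%N.
  by rewrite -(ltr_nat R); apply: lt_le_trans bD; rewrite invr_gt0.
have hD u : u \in good e p a b -> (deg e u <= D)%N by exact: deg_good.
pose Mo := (M1 + M1).+1.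
have dM x n u : (0 < n)%N -> vboundary e (B x n) u -> (gdist e x u <= M1 * n)%N.
  move=> n0 bu; have [/(_ u bu)/andP[_ h] _] := hdist x n n0.
  by rewrite -(ler_nat R) natrM; apply: le_trans h _; apply: ler_wpM2r.
have mono x j : (0 < j)%N -> B x j `<=` B x j.+1 by have [_ h _] := hB x; exact: h.
have mono' x i j : (0 < i)%N -> (i <= j)%N -> B x i `<=` B x j.
  move=> i0; elim: j => [|j IH]; first by case: i i0.
  rewrite leq_eqVlt => /predU1P[<-//|]; rewrite ltnS => ij z /(IH ij).
  by apply: mono; exact: leq_trans ij.
have fB x n : (0 < n)%N -> finite_set (B x n) /\ B x n x.
  by move=> n0; have [/(_ n n0)[? _ ?] _ _] := hB x.
have cross x h n : path e x h -> (Mo * n < gdist e x (last x h))%N ->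
    (n <= D * count [pred z | z \in good e p a b] (belast x h))%N.
  move=> ph dx; case: (posnP n) => [->//|n0].
  have dd : (M1 * n + M1 * n < gdist e x (last x h))%N.
    by apply: leq_ltn_trans dx; rewrite /Mo mulSn mulnDl leq_addl.
  have [fx Bx] := fB x n n0; have [fz Bz] := fB (last x h) n n0.
  have := not_mutually_inside hG fx fz Bx Bz (dM x n ^~ n0) (dM (last x h) n ^~ n0) dd.
  case=> nB; [apply: (@nested_boundaries _ (B x) _ _ D)|
              apply: (@nested_boundaries _ (B (last x h)) _ _ D)] => //.
  - by move=> j; exact: mono.
  - by move=> j u; exact: bgood.
  - move=> j /andP[j0 jn]; apply: path_exit => //; first by case: (fB x j j0).
    by move=> /(mono' _ _ _ j0 jn).
  - by move=> j; exact: mono.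
  - by move=> j u; exact: bgood.
  - move=> j /andP[j0 jn]; have [pr lr] := path_rev hG ph.
    have [||u ur bu] := path_exit (P := B (last x h) j) pr.
    + by case: (fB (last x h) j j0).
    + by rewrite lr => /(mono' _ _ _ j0 jn).
    exists u => //; rewrite -mem_rev.
    have : u \in last x h :: rev (belast x h) by rewrite lastI mem_rcons inE ur orbT.
    rewrite inE => /predU1P[uz|//]; have [/(_ u bu)/andP[+ _] _] := hdist (last x h) j j0.
    by rewrite uz gdist0 // leNgt mulr_gt0 // ltr0n.
exists (1 - dl), (Mo * D * L)%N; split.
- by case/andP: dl01 => ? ?; rewrite subr_ge0; apply/andP; split => //; lra.
- by rewrite !muln_gt0 D0 L0.
move=> x r k k0; set S := [set z | _].
have [L' [d' [L'0 d'01 hS]]] := stop_finite hG hp dl01 (finite_ball hG x r)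
  (ex_intro _ u0 (set_mem u0good)) hL.
have [m hm] : exists m, forall n, (m <= n)%N -> (1 - d') ^+ n < k.
  by apply: expr_lt => //; case/andP: d'01 => ? ?; rewrite subr_ge0; apply/andP; split => //; lra.
exists (m * L')%N => W xW; rewrite !divnMA.
have w01 (w : R) : 0 < w <= 1 -> 0 <= w <= 1 by case/andP=> /ltW -> ->.
apply: le_trans (lescape_bound (k := r.-1 %/ Mo %/ D) hG hp _ L0 L'0 (w01 _ dl01) (w01 _ d'01) _ _ _ xW) _.
- by move=> s; exact: hL.
- by move=> s; exact: hS.
- move=> h ph; rewrite notin_setE /= => /negP; rewrite -leqNgt => rh.
  case: (posnP r) => [->|r0]; first by rewrite !div0n.
  rewrite -[leqRHS](mulKn _ D0); apply: leq_div2r; apply: cross => //.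
  by rewrite mulnC (leq_ltn_trans (leq_trunc_div _ _)) // (leq_trans _ rh) // prednK.
by rewrite lerD2l mulnK // ltW // hm.
Qed.

End EscapeDecay.

(** * The law of the forest *)

Section Forest.
Variables (R : realType) (V : countType) (e : rel V) (p : seq V -> R).
Implicit Types (A : V -> option V) (s : seq V) (x y z : V) (W : set V).

Definition stopped (st : lerw_state V) : bool := if st is Active _ then false else true.

Lemma lerw_stopped W X Y k n : stopped (lerw e p W X Y k) -> (k <= n)%N ->
  lerw e p W X Y n = lerw e p W X Y k.
Proof.
move=> sk /subnK <-; elim: (n - k)%N => //= m ->.
by case: (lerw e p W X Y k) sk.
Qed.

Lemma lerw_spec W X Y n :
  [\/ X 0%N \in W /\ lerw e p W X Y n = AtBoundary [:: X 0%N],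
      exists2 s, live W (X 0%N) s & lerw e p W X Y n = Active s,
      exists s y, [/\ live W (X 0%N) s, y \notin s, y \in W &
        lerw e p W X Y n = AtBoundary (rcons s y)] |
      exists s y, [/\ live W (X 0%N) s, y \in s & lerw e p W X Y n = LoopKept s y]].
Proof.
elim: n => [|n IH] /=.
  rewrite /stop_in; case: ifPn => xW; first by constructor 1.
  by constructor 2; exists [:: X 0%N] => //; exact: live1.
case: IH => [[xW ->]|[s lv ->]|[s [y [lv ys yW ->]]]|[s [y [lv ys ->]]]].
- by constructor 1.
- case: (live_step e p (X n.+1) (Y n.+1) lv) => [[s' [-> lv' _]]|[ys yW ->]|[ys ->]].
  + by constructor 2; exists s'.
  + by constructor 3; exists s, (X n.+1).
  + by constructor 4; exists s, (X n.+1).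
- by constructor 3; exists s, y.
- by constructor 4; exists s, y.
Qed.

Lemma mem_zip1 s s' x y : (x, y) \in zip s s' -> x \in s.
Proof.
elim: s s' => [|a s IH] [|b s'] //=; rewrite !inE xpair_eqE.
by case/orP => [/andP[-> //]|/IH ->]; rewrite orbT.
Qed.

Lemma mem_zip_behead s x y : uniq s ->
  (x, y) \in zip s (behead s) <->
  ((index x s).+1 < size s)%N /\ nth x s (index x s).+1 = y.
Proof.
elim: s => [|a s IH]; first by move=> _; split => // -[].
rewrite cons_uniq => /andP[na us]; case: s IH na us => [|b s] IH na us.
  by split => //; case; rewrite /= ltnS; case: eqP.
rewrite [zip _ _]/= inE xpair_eqE; case: (eqVneq a x) => [ax|ax].
  rewrite ax /= !eqxx /= in na *; split.
    case/orP => [/eqP ->//|/mem_zip1 h].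
    by rewrite h in na.
  by case=> _ ->; rewrite eqxx.
rewrite /= (negPf ax); exact: (IH us).
Qed.

Definition edges A : set (edge e) :=
  [set a | exists x y, A x = Some y /\ ends a = [set x; y]].

Definition step_edges (l : seq (V * V)) : set (edge e) :=
  [set a | exists x y, (x, y) \in l /\ ends a = [set x; y]].

Lemma edges_ext A s : uniq s ->
  (forall z, ((index z s).+1 < size s)%N -> A z = None) ->
  edges (ext A s) = edges A `|` step_edges (zip s (behead s)).
Proof.
move=> us sN; apply/seteqP; split => a.
  move=> [x [y [+ ea]]]; rewrite /ext; case: ifPn => ix.
    case=> xy; right; exists x, y; split => //; apply/(mem_zip_behead x y us).
    by split => //; rewrite -xy; apply: set_nth_default.
  by move=> Ax; left; exists x, y.
case=> -[x [y [+ ea]]].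
  move=> Ax; exists x, y; split => //; rewrite /ext; case: ifPn => // ix.
  by rewrite sN in Ax.
move/(mem_zip_behead x y us) => [ix xy]; exists x, y; split => //.
by rewrite /ext ix xy.
Qed.

Lemma edges_upd A t y : A t = None ->
  edges (upd A t y) = edges A `|` [set a | ends a = [set t; y]].
Proof.
move=> At; apply/seteqP; split => a.
  move=> [x [z [+ ea]]]; rewrite /upd; case: eqP => [xt [yz]|_ Ax].
    by right; rewrite /= ea yz xt.
  by left; exists x, z.
case=> [[x [z [Ax ea]]]|ea].
  by exists x, z; split => //; rewrite upd_neq //; apply/eqP => xt; rewrite xt At in Ax.
by exists t, y; split => //; exact: updE.
Qed.

Definition represents A (F : set V * set (edge e)) := F.1 = dom A /\ F.2 = edges A.

Definition forest_add (F : set V * set (edge e)) (st : lerw_state V) :=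
  (F.1 `|` [set z | z \in state_vertices st], F.2 `|` step_edges (state_steps st)).

Lemma represents_self A F x : represents A F -> x \in dom A ->
  represents A (forest_add F (AtBoundary [:: x])).
Proof.
case=> F1 F2 xA; split; rewrite /forest_add /=.
  apply/seteqP; split => z; last by rewrite F1; left.
  by case=> [|/=]; rewrite ?F1 // inE => /eqP ->; rewrite -inE.
rewrite F2; apply/seteqP; split => a; last by left.
by case=> // -[u [w []]].
Qed.

Lemma represents_boundary A F x s y : closed_arrows A -> represents A F ->
  live (dom A) x s -> y \notin s -> y \in dom A ->
  represents (glue A (AtBoundary (rcons s y))) (forest_add F (AtBoundary (rcons s y))).
Proof.
move=> cA [F1 F2] lv ys yA; have [cB dB] := glue_boundary cA lv ys yA.
split; first by rewrite dB /= F1.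
have [_ us sW] := lv; rewrite /= F2 edges_ext ?rcons_uniq ?ys // => z.
rewrite size_rcons ltnS -cats1 index_cat; case: ifPn => [zs _|_].
  by move: (sW _ zs); rewrite in_dom negbK => /eqP.
by rewrite ltnNge leq_addr.
Qed.

Lemma zip_loop x s y : zip (x :: s) (rcons s y) = rcons (zip (x :: s) s) (last x s, y).
Proof. by elim: s x => //= a s IH x; rewrite -IH. Qed.

Lemma represents_loop A F x s y : closed_arrows A -> represents A F ->
  live (dom A) x s -> y \in s ->
  represents (glue A (LoopKept s y)) (forest_add F (LoopKept s y)).
Proof.
move=> cA [F1 F2] lv ys; have [cB dB] := glue_loop cA lv ys.
split; first by rewrite dB /= F1.
have [sx us sW] := lv.
have sN z : z \in s -> A z = None.
  by move=> /sW; rewrite in_dom negbK => /eqP.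
have lS := live_last lv.
rewrite /= (live_lastx y lv) edges_upd; last by rewrite ext_last ?sN.
rewrite edges_ext // => [|z iz]; last first.
  by apply: sN; rewrite -index_mem ltnW.
rewrite F2 -setUA (setUC (step_edges _)); congr (_ `|` _).
have -> : zip s (rcons (behead s) y) = rcons (zip s (behead s)) (last x s, y).
  by rewrite sx; exact: zip_loop.
apply/seteqP; split => a.
  move=> [u [w [+ ea]]]; rewrite mem_rcons inE xpair_eqE.
  case/orP => [/andP[/eqP uE /eqP wE]|uw]; first by left; rewrite /= ea uE wE.
  by right; exists u, w.
case=> [ea|[u [w [uw ea]]]]; [exists (last x s), y|exists u, w]; split => //.
  by rewrite mem_rcons mem_head.
by rewrite mem_rcons inE uw orbT.
Qed.

Section Realization.
Variables (v : nat -> V) (X : V -> nat -> V) (Y : V -> nat -> R).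

Local Notation forest := (@forest R V e p v X Y).
Local Notation walk i := (lerw e p (forest i).1 (X (v i)) (Y (v i))).

Lemma forestS_stopped i k st : walk i k = st -> stopped st ->
  forest i.+1 = forest_add (forest i) st.
Proof.
move=> Lk sst.
have LE n : stopped (walk i n) -> walk i n = st.
  move=> sn; rewrite -Lk; case: (leqP n k) => nk.
    by rewrite (lerw_stopped sn nk).
  by rewrite (lerw_stopped _ (ltnW nk)) // Lk.
rewrite /= /forest_add; congr pair; congr (_ `|` _); apply/seteqP; split => z.
- move=> [n zn]; rewrite /= -(LE n) //.
  by move: zn; case: (walk i n).
- by move=> zst; exists k; rewrite Lk.
- move=> [n [x [y [xy ez]]]]; exists x, y; split => //; rewrite -(LE n) //.
  by move: xy; case: (walk i n).
- by move=> [x [y [xy ez]]]; exists k, x, y; rewrite Lk.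
Qed.

Lemma forest_mono i j : (i <= j)%N -> (forest i).1 `<=` (forest j).1.
Proof.
move=> /subnK <-; elim: (j - i)%N => // m IH z /IH h.
by rewrite addSn; left.
Qed.

Lemma forest_mono2 i j : (i <= j)%N -> (forest i).2 `<=` (forest j).2.
Proof.
move=> /subnK <-; elim: (j - i)%N => // m IH z /IH h.
by rewrite addSn; left.
Qed.

Lemma lerw_steps_notin W Z U n x y :
  (x, y) \in state_steps (lerw e p W Z U n) -> x \notin W.
Proof.
case: (lerw_spec W Z U n) => [[_ ->]|[s _ ->]|[s [u [lv us _ ->]]]|[s [u [lv _ ->]]]] //.
  have [_ us' sW] := lv.
  have ur : uniq (rcons s u) by rewrite rcons_uniq us.
  move/(mem_zip_behead _ _ ur) => [+ _]; rewrite size_rcons ltnS -cats1 index_cat.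
  case: ifPn => [/sW //|_]; by rewrite ltnNge leq_addr.
by move/mem_zip1; have [_ _ sW] := lv; exact: sW.
Qed.

Lemma full_forest_edge N (a : edge e) : (forall z, ends a z -> (forest N).1 z) ->
  full_forest p v X Y a <-> (forest N).2 a.
Proof.
move=> aN; split; last by move=> h; exists N.
case=> i _; elim: i => // i IH; case: (leqP i.+1 N) => iN; first exact: forest_mono2.
case=> [/IH//|[n [x [y [/lerw_steps_notin xi ea]]]]].
case/negP: xi; apply/mem_set; apply: (forest_mono (i := N)) => //.
by apply: aN; rewrite ea; left.
Qed.

End Realization.
End Forest.

Section Probability.
Context {R : realType} {d : measure_display} {T : measurableType d}.
Variable P : probability T R.
Implicit Types (A B : set T).

Definition pr A : R := fine (P A).

Lemma prE A : measurable A -> P A = (pr A)%:E.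
Proof. by move=> mA; rewrite /pr fineK // fin_num_measure. Qed.

Lemma pr_ge0 A : measurable A -> 0 <= pr A.
Proof. by move=> mA; rewrite -lee_fin -prE. Qed.

Lemma pr_le A B : measurable A -> measurable B -> A `<=` B -> pr A <= pr B.
Proof. by move=> mA mB AB; rewrite -lee_fin -!prE //; apply: le_measure; rewrite ?inE. Qed.

Lemma pr_setT : pr [set: T] = 1.
Proof. by apply: EFin_inj; rewrite -prE // probability_setT. Qed.

Lemma pr_split A B : measurable A -> measurable B ->
  pr A = pr (A `&` B) + pr (A `&` ~` B).
Proof.
move=> mA mB; have mAB := measurableI _ _ mA mB.
have mAC := measurableI _ _ mA (measurableC mB).
apply: EFin_inj; rewrite EFinD -!prE //.
have {1}-> : A = (A `&` B) `|` (A `&` ~` B) by rewrite -setIUr setUv setIT.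
rewrite measureU //.
by rewrite setIACA setICr setI0.
Qed.

Lemma pr_setC A : measurable A -> pr (~` A) = 1 - pr A.
Proof.
move=> mA; have := pr_split measurableT mA; rewrite pr_setT !setTI => ->.
by rewrite addrC addKr.
Qed.

Lemma pr_sum_le (V : eqType) (l : seq V) (f : T -> V) A : uniq l -> measurable A ->
  (forall y, measurable [set w | f w = y]) ->
  \sum_(y <- l) pr (A `&` [set w | f w = y]) <= pr A.
Proof.
move=> + + mf; elim: l A => [|y l IH] A; first by rewrite big_nil => _; exact: pr_ge0.
rewrite cons_uniq => /andP[yl ul] mA; rewrite big_cons (pr_split mA (mf y)) lerD2l.
have mC := measurableI _ _ mA (measurableC (mf y)).
apply: le_trans (IH _ ul mC); rewrite big_seq [leRHS]big_seq.
apply: ler_sum => z zl; apply: pr_le; try exact: measurableI.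
by move=> w [Aw fz]; split => //; split => //= fy; rewrite -fy fz zl in yl.
Qed.

Lemma measurable_countable (D : Type) (f : T -> D) (h : D -> T -> Prop) :
  countable [set: D] -> (forall z, measurable [set w | f w = z]) ->
  (forall z, measurable [set w | h z w]) -> measurable [set w | h (f w) w].
Proof.
move=> cD mf mh.
have -> : [set w | h (f w) w] = \bigcup_z ([set w | f w = z] `&` [set w | h z w]).
  apply/seteqP; split => w; first by move=> hw; exists (f w).
  by move=> [z _ [/= <-]].
by apply: countable_bigcupT_measurable => // z; apply: measurableI.
Qed.

Lemma measurable_Prop (C : Prop) : measurable [set _ : T | C].
Proof.
case: (pselect C) => c.
  by rewrite (_ : [set _ | _] = setT) //; apply/seteqP; split.
by rewrite (_ : [set _ | _] = set0) //; apply/seteqP; split.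
Qed.

Lemma measurable_if (D : Type) (b : T -> bool) (y z x : D) :
  measurable [set w | b w] -> measurable [set w | (if b w then y else z) = x].
Proof.
move=> mb; have -> : [set w | (if b w then y else z) = x] =
    ([set w | b w] `&` [set _ | y = x]) `|` (~` [set w | b w] `&` [set _ | z = x]).
  apply/seteqP; split => w /=; case: ifP => bw.
  - by left.
  - by right; split => //; rewrite bw.
  - by case=> [[]//|[]].
  - by case=> [[]//|[]].
by apply: measurableU; apply: measurableI => //; try exact: measurable_Prop;
  exact: measurableC.
Qed.

End Probability.

Lemma uniform_prob_le (R : realType) (a : R) : 0 <= a <= 1 ->
  uniform_prob (@ltr01 R) [set u | u <= a] = a%:E.
Proof.
move=> /andP[a0 a1]; rewrite /uniform_prob integral_uniform_pdf.
have -> : [set u | u <= a] `&` `[0, 1] = `[0, a]%classic.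
  apply/seteqP; split => u /=; rewrite !in_itv /=.
    by move=> [ua /andP[-> _]].
  by move=> /andP[u0 ua]; rewrite u0 ua (le_trans ua).
under eq_integral => u.
  rewrite inE /= in_itv /= => /andP[u0 ua].
  rewrite /uniform_pdf u0 (le_trans ua a1) /= subr0 invr1.
  over.
rewrite integral_cst //= mul1e lebesgue_measure_itv /= lte_fin.
case: ltP => [_|a0']; first by rewrite oppr0 adde0.
by have /eqP -> : a == 0 by rewrite eq_le a0 a0'.
Qed.

Lemma countable_lerw_state (V : countType) : countable [set: lerw_state V].
Proof.
apply/countable_injP; exists (fun st => choice.pickle (match st return nat * seq V * option V with
  | Active s => (0%N, s, None)
  | AtBoundary s => (1%N, s, None)
  | LoopKept s y => (2%N, s, Some y)
  end)).
by move=> [s|s|s y] [s'|s'|s' y'] _ _ /(pcan_inj choice.pickleK) // [] => [->|->|-> ->].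
Qed.

Section Measurability.
Variables (R : realType) (V : countType) (e : rel V) (p : seq V -> R).
Context {d : measure_display} {T : measurableType d}.
Variables (P : probability T R).
Variables (X : V -> nat -> T -> V) (Y : V -> nat -> {RV P >-> R}) (v : nat -> V).
Hypothesis mX : forall x n y, measurable [set w | X x n w = y].

Lemma measurable_noise_le x n (a : R) : measurable [set w | Y x n w <= a].
Proof.
have := measurable_funPT (Y x n) measurableT _ (measurable_itv `]-oo, a]).
rewrite setTI; congr measurable; apply/seteqP; split => w /=; by rewrite in_itv.
Qed.

Lemma measurable_lerw (W : T -> set V) x n st :
  (forall z, measurable [set w | W w z]) ->
  measurable [set w | lerw e p (W w) (fun m => X x m w) (fun m => Y x m w) n = st].
Proof.
move=> mW.
have mS y s st' : measurable [set w | stop_in (W w) y s = st'].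
  apply: measurable_if; rewrite (_ : [set w | _] = [set w | W w y]) //.
  by apply/seteqP; split => w /=; rewrite inE.
have cV : countable [set: V] by exact: countableP.
elim: n st => [|n IH] st /=.
  exact: (measurable_countable (f := X x 0%N)
    (h := fun y w => stop_in (W w) y [:: y] = st)).
apply: (measurable_countable (h := fun st' w =>
    lerw_step e p (W w) st' (X x n.+1 w) (Y x n.+1 w) = st)) => // [|st'].
  exact: countable_lerw_state.
apply: (measurable_countable (f := X x n.+1) (h := fun y w =>
    lerw_step e p (W w) st' y (Y x n.+1 w) = st)) => // y.
case: st' => [s|s|s z] /=; try exact: measurable_Prop.
case: (boolP (y \in s)) => ys //=.
have mY := measurable_noise_le x n.+1 (loop_weight e p (drop (index y s) s)).
rewrite (_ : [set w | _] =
  ([set w | Y x n.+1 w <= loop_weight e p (drop (index y s) s)] `&` [set _ | LoopKept s y = st])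
  `|` (~` [set w | Y x n.+1 w <= loop_weight e p (drop (index y s) s)] `&`
       [set w | stop_in (W w) y (take (index y s).+1 s) = st])).
  apply: measurableU; apply: measurableI => //; first exact: measurable_Prop.
  exact: measurableC.
apply/seteqP; split => w /=; case: ifP => yw.
- by left.
- by right; split => //; rewrite yw.
- by case=> [[]//|[]].
- by case=> [[]//|[]].
Qed.

Local Notation forest w := (@forest R V e p v (fun x n => X x n w) (fun x n => Y x n w)).

Lemma measurable_forest i :
  (forall z, measurable [set w | (forest w i).1 z]) /\
  (forall a, measurable [set w | (forest w i).2 a]).
Proof.
elim: i => [|i [IH1 IH2]]; first by split => z; exact: measurable_Prop.
have mL n st := measurable_lerw (v i) n st IH1.
split => z.
  apply: (@measurableU _ _ [set w | (forest w i).1 z]) => //.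
  rewrite (_ : (fun _ => _) = \bigcup_n [set w | z \in state_vertices
    (lerw e p (forest w i).1 (fun m => X (v i) m w) (fun m => Y (v i) m w) n)]); last first.
    by apply/seteqP; split => w [n]; [exists n|move=> _; exists n].
  apply: bigcupT_measurable => n.
  apply: (measurable_countable (h := fun st _ => z \in state_vertices st)) => //.
    exact: countable_lerw_state.
  by move=> st; exact: measurable_Prop.
apply: (@measurableU _ _ [set w | (forest w i).2 z]) => //.
rewrite (_ : (fun _ => _) = \bigcup_n [set w | exists x y, (x, y) \in state_steps
    (lerw e p (forest w i).1 (fun m => X (v i) m w) (fun m => Y (v i) m w) n)
    /\ ends z = [set x; y]]); last first.
  by apply/seteqP; split => w [n]; [exists n|move=> _; exists n].
apply: bigcupT_measurable => n.
apply: (measurable_countable (h := fun st _ => exists x y,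
  (x, y) \in state_steps st /\ ends z = [set x; y])) => //.
  exact: countable_lerw_state.
by move=> st; exact: measurable_Prop.
Qed.

Lemma measurable_full_forest (a : edge e) :
  measurable [set w | full_forest p v (fun x n => X x n w) (fun x n => Y x n w) a].
Proof.
rewrite (_ : [set w | _] = \bigcup_i [set w | (forest w i).2 a]).
  by apply: bigcupT_measurable => i; case: (measurable_forest i).
by apply/seteqP; split => w [i]; exists i.
Qed.

End Measurability.

Section Law.
Variables (R : realType) (V : countType) (e : rel V) (p : seq V -> R).
Hypothesis hG : infinite_graph e.
Hypothesis hp : cycle_weight e p.
Context {d : measure_display} {T : measurableType d}.
Variables (P : probability T R).
Variables (X : V -> nat -> T -> V) (Y : V -> nat -> {RV P >-> R}) (v : nat -> V).
Hypothesis hN : driving_noise e X Y.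
Hypothesis v_inj : injective v.
Implicit Types (A : V -> option V) (s : seq V) (x y z : V).
Implicit Types (J : {fset (V + V * nat)%type}) (E : V + V * nat -> set T).

Local Notation pr := (pr P).
Local Notation forest w := (@forest R V e p v (fun x n => X x n w) (fun x n => Y x n w)).
Local Notation walk w i := (lerw e p (forest w i).1 (fun n => X (v i) n w)
  (fun n => Y (v i) n w)).

Lemma measurable_srw x n y : measurable [set w | X x n w = y].
Proof. by case: hN => /(_ x)[mX _ _] _ _; exact: mX. Qed.

Definition noise_events (i : V + V * nat) : set (set T) :=
  match i with
  | inl x => walk_sigma (X x)
  | inr xn => preimage_set_system setT (Y xn.1 xn.2) measurable
  end.

Lemma measurable_noise i B : noise_events i B -> measurable B.
Proof.
case: i => [x|[x n]] /=; last first.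
  by case=> C mC <-; rewrite setTI -[X in measurable X]setTI; exact: measurable_funPT.
apply; split; first exact: sigma_algebra_measurable.
by move=> _ [n [y ->]]; exact: measurable_srw.
Qed.

Definition rect J E : set T := \bigcap_(i in [set` J]) E i.

Definition setE E i B := fun j => if j == i then B else E j.

Lemma setE_same E i B : setE E i B i = B. Proof. by rewrite /setE eqxx. Qed.

Lemma setE_neq E i B j : j != i -> setE E i B j = E j.
Proof. by rewrite /setE => /negPf ->. Qed.

Definition noise_rect J E := forall i, i \in J -> noise_events i (E i).

Lemma measurable_rect J E : noise_rect J E -> measurable (rect J E).
Proof.
move=> h; apply: fin_bigcap_measurable => // i iJ.
by apply: measurable_noise; exact: h.
Qed.

Lemma pr_rect J E : noise_rect J E -> pr (rect J E) = \prod_(i <- J) pr (E i).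
Proof.
move=> h; apply: EFin_inj; rewrite -prE; last exact: measurable_rect.
case: hN => _ _ ind; rewrite /rect (ind J E); last by move=> i /h; case: i.
rewrite big_seq [in RHS]big_seq; elim/big_rec2: _ => // i a b iJ ->.
by rewrite EFinM -prE //; apply: measurable_noise; exact: h.
Qed.

Lemma noise_rect_setE J E i B : noise_rect J E -> noise_events i B ->
  noise_rect J (setE E i B).
Proof.
move=> h hB j jJ; case: (eqVneq j i) => [->|ji]; first by rewrite setE_same.
by rewrite setE_neq //; exact: h.
Qed.

Lemma noise_rectU J E i B : noise_rect J E -> noise_events i B ->
  noise_rect (i |` J)%fset (setE E i B).
Proof.
move=> h hB j; rewrite in_fset1U; case: (eqVneq j i) => [->|ji] /=.
  by rewrite setE_same.
by rewrite setE_neq //; exact: h.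
Qed.

Lemma rectU J E i B : i \notin J ->
  rect (i |` J)%fset (setE E i B) = rect J E `&` B.
Proof.
move=> iJ; apply/seteqP; split => w.
  move=> h; split; last by have := h i; rewrite setE_same; apply; rewrite /= fset1U1.
  move=> j jJ; have := h j; rewrite setE_neq; first by apply; rewrite /= fset1Ur.
  by apply: contraNneq iJ => <-.
move=> [h hB] j /=; rewrite in_fset1U; case: (eqVneq j i) => [->|ji] /=.
  by rewrite setE_same.
by rewrite setE_neq //; exact: h.
Qed.

Lemma pr_rectU J E i B : noise_rect J E -> noise_events i B -> i \notin J ->
  pr (rect (i |` J)%fset (setE E i B)) = pr B * pr (rect J E).
Proof.
move=> h hB iJ; rewrite pr_rect; last exact: noise_rectU.
rewrite big_fsetU1 // setE_same pr_rect //; congr (_ * _).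
rewrite big_seq [RHS]big_seq; apply: eq_bigr => j jJ; rewrite setE_neq //.
by apply: contraNneq iJ => <-.
Qed.

Lemma pr_rect_setE J E i : noise_rect J E -> i \in J ->
  exists r, forall B, noise_events i B -> pr (rect J (setE E i B)) = pr B * r.
Proof.
move=> h iJ; exists (\prod_(j <- (J `\ i)%fset) pr (E j)) => B hB.
rewrite pr_rect; last exact: noise_rect_setE.
rewrite (big_fsetD1 i) //= setE_same; congr (_ * _).
rewrite big_seq [RHS]big_seq; apply: eq_bigr => j.
by rewrite in_fsetD1 => /andP[ji _]; rewrite setE_neq.
Qed.

Definition path_event x s : set T :=
  [set w | X x 0%N w = x /\ [seq X x n.+1 w | n <- iota 0 (size s)] = s].

Lemma map_iotaS (f : nat -> V) n :
  [seq f i | i <- iota 0 n.+1] = rcons [seq f i | i <- iota 0 n] (f n).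
Proof. by rewrite -[in LHS]addn1 iotaD map_cat cats1. Qed.

Lemma path_event_rcons x s y :
  path_event x (rcons s y) = path_event x s `&` [set w | X x (size s).+1 w = y].
Proof.
apply/seteqP; split => w; rewrite /path_event /= size_rcons map_iotaS.
  by move=> [? /rcons_inj[? ?]].
by move=> [[-> ->] ->].
Qed.

Lemma walk_sigmaI x : setI_closed (walk_sigma (X x)).
Proof.
have := smallest_sigma_algebra setT [set B : set T | exists n y, B = X x n @^-1` [set y]].
by case/(sigma_algebraP (fun B _ => @subsetT _ B)).
Qed.

Lemma path_event_noise x s : noise_events (inl x) (path_event x s).
Proof.
have hX n y : noise_events (inl x) [set w | X x n w = y].
  by apply: sub_sigma_algebra; exists n, y.
elim/last_ind: s => [|s y IH].
  by rewrite (_ : path_event x [::] = [set w | X x 0%N w = x]) //;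
    apply/seteqP; split => w //= -[].
by rewrite path_event_rcons; apply: walk_sigmaI => //; exact: hX.
Qed.

Lemma pr_path_event x s : pr (path_event x s) = srw_prob R e x s.
Proof.
case: hN => /(_ x)[mX X0 Xs] _ _.
have m0 := measurable_srw x 0 x.
have mS : measurable [set w | [seq X x n.+1 w | n <- iota 0 (size s)] = s].
  elim/last_ind: s {Xs} => [|s y IH].
    by rewrite (_ : [set w | _] = setT) //; apply/seteqP; split.
  rewrite (_ : [set w | _] = [set w | [seq X x n.+1 w | n <- iota 0 (size s)] = s]
    `&` [set w | X x (size s).+1 w = y]).
    by apply: measurableI => //; exact: measurable_srw.
  apply/seteqP; split => w; rewrite /= size_rcons map_iotaS.
    by move=> /rcons_inj[? ?].
  by move=> [-> ->].
have -> : srw_prob R e x s = pr [set w | [seq X x n.+1 w | n <- iota 0 (size s)] = s].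
  by apply: EFin_inj; rewrite -prE // Xs.
rewrite (pr_split P mS m0) setIC (_ : pr (_ `&` ~` _) = 0) ?addr0 //.
apply/eqP; rewrite eq_le pr_ge0 ?andbT; last by apply: measurableI => //; exact: measurableC.
apply: (@le_trans _ _ (pr (~` [set w | X x 0%N w = x]))).
  by apply: pr_le; [apply: measurableI => //; exact: measurableC|exact: measurableC|move=> w []].
by rewrite pr_setC // (_ : pr _ = 1) ?subrr //; apply: EFin_inj; rewrite -prE.
Qed.

Lemma pr_noise_le x n (a : R) : 0 <= a <= 1 -> pr [set w | Y x n w <= a] = a.
Proof.
move=> a01; apply: EFin_inj; rewrite -(uniform_prob_le a01).
rewrite -prE; last exact: measurable_noise_le.
case: hN => _ hY _; rewrite -(hY x n) //.
by rewrite -(set_itvNyc a).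
Qed.

Lemma noise_le_event x n (a : R) : noise_events (inr (x, n)) [set w | Y x n w <= a].
Proof.
exists `]-oo, a]%classic; first exact: measurable_itv.
by rewrite setTI; apply/seteqP; split => w /=; rewrite in_itv.
Qed.

Lemma noise_gt_event x n (a : R) :
  noise_events (inr (x, n)) (~` [set w | Y x n w <= a]).
Proof.
exists (~` `]-oo, a]%classic); first by apply: measurableC; exact: measurable_itv.
by rewrite setTI; apply/seteqP; split => w /=; rewrite in_itv.
Qed.

Variables (N : nat) (G : set T) (g : (V -> option V) -> R).
Hypothesis mG : measurable G.
Hypothesis g01 : forall B, 0 <= g B <= 1.
Hypothesis Gg : forall w A, closed_arrows A -> represents A (forest w N) ->
  (forall j, (j < N)%N -> A (v j) != None) -> g A != 0 -> G w.

Let starts i := [seq v j | j <- iota i (N - i)].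

Let startsS i : (i < N)%N -> starts i = v i :: starts i.+1.
Proof. by move=> iN; rewrite /starts -(subnSK iN). Qed.

Definition fresh i J E := noise_rect J E /\
  forall j, (i <= j)%N -> inl (v j) \notin J /\ forall m, inr (v j, m) \notin J.

Definition past i s J E :=
  [/\ noise_rect J E, inl (v i) \in J, E (inl (v i)) = path_event (v i) s,
      forall m, (size s < m)%N -> inr (v i, m) \notin J &
      forall j, (i < j)%N -> inl (v j) \notin J /\ forall m, inr (v j, m) \notin J].

Let Bound_fresh n := forall i J E A, (i <= N)%N -> fresh i J E -> closed_arrows A ->
  (forall j, (j < i)%N -> A (v j) != None) ->
  (forall w, rect J E w -> represents A (forest w i)) ->
  pr (rect J E) * val e p (starts i) g n A <= pr (rect J E `&` G).

Let Bound_active n := forall i J E A s h, (i < N)%N -> past i h J E ->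
  closed_arrows A -> (forall j, (j < i)%N -> A (v j) != None) ->
  live (dom A) (v i) s -> last (v i) h = last (v i) s ->
  (forall w, rect J E w ->
     represents A (forest w i) /\ walk w i (size h) = Active s) ->
  pr (rect J E) * val e p (starts i) g n (ext A s) <= pr (rect J E `&` G).

Lemma bound_fresh n : Bound_active n -> Bound_fresh n.
Proof.
move=> hact i J E A iN; move Ek : (N - i)%N => k.
elim: k i J E Ek iN => [|k IH] i J E Ek iN [hJ un] cA Aj hw.
  have iE : i = N by apply/eqP; rewrite eqn_leq iN -subn_eq0 Ek.
  have mr := measurable_rect hJ.
  rewrite /starts Ek /= /val run_done //.
  have /andP[g0 g1] := g01 A.
  case: (eqVneq (g A) 0) => [->|gA].
    by rewrite mulr0; apply: pr_ge0; exact: measurableI.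
  rewrite (_ : rect J E `&` G = rect J E); first by rewrite ler_piMr // pr_ge0.
  apply/setIidPl => w rw; apply: (Gg cA) => //; first by rewrite -iE; exact: hw.
  by rewrite -iE.
have iN' : (i < N)%N by rewrite -subn_gt0 Ek.
have [iJ iJm] := un i (leqnn i).
set B := path_event (v i) [::].
have nB : noise_events (inl (v i)) B by exact: path_event_noise.
have rE := rectU E B iJ.
have nr := noise_rectU hJ nB.
have prr := pr_rectU hJ nB iJ.
rewrite pr_path_event mul1r in prr.
rewrite -prr; apply: (@le_trans _ _ (pr (rect (inl (v i) |` J)%fset (setE E (inl (v i)) B) `&` G))); last first.
  have m1 := measurable_rect hJ; have m2 := measurable_rect nr.
  apply: pr_le; try exact: measurableI.
  by rewrite rE; apply: setSI => w [].
have un' j : (i < j)%N -> inl (v j) \notin (inl (v i) |` J)%fset /\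
    forall m, inr (v j, m) \notin (inl (v i) |` J)%fset.
  move=> ij; have [h1 h2] := un j (ltnW ij); split=> [|m]; rewrite in_fset1U negb_or ?h1 ?h2 ?andbT //.
  by apply/eqP => -[/v_inj ji]; rewrite ji ltnn in ij.
case Ai : (A (v i)) => [u|].
  rewrite startsS // /val (run_cons_done hG hp); last by apply: closed_tip; rewrite ?Ai.
  apply: IH => //.
  - by rewrite subnS Ek.
  - by move=> j; rewrite ltnS leq_eqVlt => /predU1P[->|/Aj//]; rewrite Ai.
  - move=> w; rewrite rE => -[rw [Xw _]]; have rep := hw w rw.
    have vd : v i \in dom A by rewrite in_dom Ai.
    rewrite (@forestS_stopped _ _ _ _ _ _ _ i 0 (AtBoundary [:: v i])) //.
      exact: represents_self.
    by case: rep => F1 _; rewrite /= Xw F1 /stop_in vd.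
rewrite -[A in val _ _ _ _ _ A](ext1 _ (v i)); apply: (hact _ _ _ _ _ [::]) => //.
- split => //; first by rewrite fset1U1.
  + by rewrite setE_same.
  + by move=> m _; rewrite in_fset1U negb_or iJm.
- by apply: live1; rewrite in_dom Ai.
- move=> w; rewrite rE => -[rw [Xw _]]; have rep := hw w rw; split => //.
  by case: rep => F1 _; rewrite /= Xw F1 /stop_in in_dom Ai.
Qed.

Lemma lerw_step_eq W s y (u u' : R) :
  (u <= loop_weight e p (drop (index y s) s)) =
  (u' <= loop_weight e p (drop (index y s) s)) ->
  lerw_step e p W (Active s) y u = lerw_step e p W (Active s) y u'.
Proof. by rewrite /lerw_step => ->. Qed.

Lemma bound_active n : Bound_fresh n -> Bound_active n -> Bound_active n.+1.
Proof.
move=> hfr hact i J E A s h iN [hJ iJ Ei mJ un] cA Aj lv lh hw.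
have mr := measurable_rect hJ.
set x := v i in iJ Ei mJ lv lh *.
have [r hr] := pr_rect_setE hJ iJ.
have setE_id : setE E (inl x) (path_event x h) = E.
  by apply/funext => j; rewrite /setE; case: eqP => // ->.
have prJ : pr (rect J E) = srw_prob R e x h * r.
  by rewrite -[in LHS]setE_id hr ?pr_path_event //; exact: path_event_noise.
rewrite startsS // /val (runS _ _ _ _ _ (first_tip_ext _ lv)) ?inE //.
rewrite (reveal_ext e p _ cA lv) -startsS // -/(val e p (starts i) g n).
set F := _ \o _; set t := last x s; set k := size h.
pose E1 y := setE E (inl x) (path_event x (rcons h y)).
pose c y := loop_weight e p (drop (index y s) s).
pose Yle y := [set w | Y x k.+1 w <= c y].
have nE1 y : noise_rect J (E1 y).
  by apply: noise_rect_setE => //; exact: path_event_noise.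
have rE1 y : rect J (E1 y) = rect J E `&` [set w | X x k.+1 w = y].
  apply/seteqP; split => w.
    move=> hE1; have := hE1 _ iJ; rewrite /E1 setE_same path_event_rcons => -[ph Xy].
    split => // j jJ; case: (eqVneq j (inl x)) => [->|ji]; first by rewrite Ei.
    by have := hE1 _ jJ; rewrite /E1 setE_neq.
  move=> [rw Xy] j jJ; rewrite /E1; case: (eqVneq j (inl x)) => [->|ji].
    by rewrite setE_same path_event_rcons; split => //; rewrite -Ei; exact: rw.
  by rewrite setE_neq //; exact: rw.
have prE1 y : e t y -> pr (rect J (E1 y)) = (deg e t)%:R^-1 * pr (rect J E).
  move=> ty; rewrite /E1 hr; last exact: path_event_noise.
  by rewrite pr_path_event srw_prob_rcons lh ty prJ mulrAC mulrC mulrA mulrC.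
have c01 y : 0 <= c y <= 1 by exact: (loop_weight01 hp).
have kJ : inr (x, k.+1) \notin J by exact: mJ.
have key y u B : e t y -> noise_events (inr (x, k.+1)) B ->
    (forall w, B w -> (Y x k.+1 w <= c y) = (u <= c y)) ->
    pr B * pr (rect J (E1 y)) * F (lerw_step e p (dom A) (Active s) y u) <=
    pr (rect J (E1 y) `&` B `&` G).
  move=> ty nB hB; have nr := noise_rectU (nE1 y) nB.
  rewrite -(rectU _ _ kJ) -(pr_rectU (nE1 y) nB kJ).
  set J' := (_ |` _)%fset; set E' := setE _ _ _.
  have rw' w : rect J' E' w -> [/\ represents A (forest w i) &
      walk w i k.+1 = lerw_step e p (dom A) (Active s) y u].
    rewrite rectU // rE1 => -[[rw Xy] Bw]; have [rep wk] := hw w rw; split => //.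
    by rewrite /= wk; case: rep => -> _; rewrite Xy; apply: lerw_step_eq; exact: hB.
  have un' j : (i < j)%N -> inl (v j) \notin J' /\ forall m, inr (v j, m) \notin J'.
    move=> ij; have [h1 h2] := un j ij; split=> [|m]; rewrite in_fset1U negb_or ?h1 ?h2 ?andbT //.
    by apply/eqP => -[/v_inj ji _]; rewrite ji ltnn in ij.
  have term st : stopped st -> lerw_step e p (dom A) (Active s) y u = st ->
      closed_arrows (glue A st) ->
      dom (glue A st) = dom A `|` [set z | z \in state_vertices st] ->
      x \in state_vertices st ->
      (forall w, represents A (forest w i) ->
         represents (glue A st) (forest_add (forest w i) st)) ->
      pr (rect J' E') * F st <= pr (rect J' E' `&` G).
    move=> sst stE cB dB xst repB.
    have dB' z : z \in dom A \/ z \in state_vertices st -> glue A st z != None.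
      by move=> hz; rewrite -in_dom dB inE; case: hz => hz; [left; rewrite -inE|right].
    have xB : glue A st x != None by apply: dB'; right.
    rewrite /F /= /val startsS // (run_cons_done hG hp); last exact: closed_tip.
    apply: hfr => //.
    - move=> j; rewrite ltnS leq_eqVlt => /predU1P[->//|/Aj Ajj].
      by apply: dB'; left; rewrite in_dom.
    - move=> w /rw'[rep wk]; rewrite (forestS_stopped (k := k.+1) (st := st)) //.
        exact: repB.
      by rewrite wk.
  have lx := live_head lv.
  case: (live_step e p y u lv) => [[s' [stE lv' ls']]|[ys yA stE]|[ys stE]].
  - rewrite stE; apply: (hact i J' E' A s' (rcons h y)) => //.
    + split => //; first by rewrite in_fset1U iJ orbT.
      * by rewrite /E' setE_neq // /E1 setE_same.
      * move=> m; rewrite size_rcons => km; rewrite in_fset1U negb_or mJ ?andbT; last exact: ltnW.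
        by apply/eqP => -[mk]; rewrite mk ltnn in km.
    + by rewrite last_rcons ls'.
    + by move=> w /rw'[rep wk]; split => //; rewrite size_rcons wk stE.
  - have [cB dB] := glue_boundary cA lv ys yA.
    rewrite stE; apply: term => //; first by rewrite /= mem_rcons inE lx orbT.
    by move=> w rep; exact: (represents_boundary (x := x)).
  - have [cB dB] := glue_loop cA lv ys.
    rewrite stE; apply: term => //.
    by move=> w rep; exact: (represents_loop (x := x)).
apply: le_trans (pr_sum_le P (uniq_nbrs e t) (measurableI _ _ mr mG) (measurable_srw x k.+1)).
rewrite /lstep mulrCA mulrA mulr_sumr big_seq [leRHS]big_seq; apply: ler_sum => y.
rewrite (mem_nbrs hG) => ty; rewrite -(prE1 y ty) setIAC -rE1.
have mY := measurable_noise_le Y x k.+1 (c y).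
have mrG : measurable (rect J (E1 y) `&` G).
  by apply: measurableI => //; exact: measurable_rect.
rewrite (pr_split P mrG mY) /lbranch -/(c y) mulrDr.
have /andP[c0 c1] := c01 y.
apply: lerD.
  rewrite mulrA [_ * c y]mulrC setIAC -{1}(pr_noise_le x k.+1 (c01 y)).
  apply: key => //; first exact: noise_le_event.
  by move=> w /= ->; rewrite lexx.
rewrite mulrA [_ * (1 - c y)]mulrC setIAC -{1}(pr_noise_le x k.+1 (c01 y)) -(pr_setC P mY).
apply: key => //; first exact: noise_gt_event.
by move=> w /= /negP/negPf ->; rewrite gerDl ler10.
Qed.

Lemma pr_ge_val n : val e p (starts 0) g n (fun=> None) <= pr G.
Proof.
have ba m : Bound_active m.
  elim: m => [|m IH]; last by apply: bound_active => //; exact: bound_fresh.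
  move=> i J E A s h iN [hJ _ _ _ _] _ _ lv _ _.
  rewrite startsS // /val (run0 _ _ _ _ (first_tip_ext _ lv)) ?inE // mulr0.
  by apply: pr_ge0; apply: measurableI => //; exact: measurable_rect.
have rT E : rect fset0 E = setT by apply/seteqP; split.
have := @bound_fresh n (ba n) 0%N fset0 (fun=> setT) (fun=> None).
rewrite rT pr_setT setTI mul1r; apply => //.
by move=> w _; split; apply/seteqP; split => // a [x [y []]].
Qed.

End Law.

(** * Decorrelation *)

Section Approximation.
Variables (R : realType) (V : countType) (e : rel V) (p : seq V -> R).
Hypothesis hG : infinite_graph e.
Hypothesis hp : cycle_weight e p.
Hypothesis hloop : uniform_loop e p.
Variable mu : probability (config e) R.
Hypothesis hmu : is_mu_p p mu.
Implicit Types (l : seq V) (Q : set (config e)) (A B : V -> option V).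

Lemma measurable_edge_open (a : edge e) : measurable (edge_open a).
Proof. by apply: sub_sigma_algebra; exists a. Qed.

Definition local l Q := forall F F' : set (edge e),
  (forall a : edge e, (forall z, ends a z -> z \in l) -> F a <-> F' a) -> Q F -> Q F'.

Lemma local_setC l Q : local l Q -> local l (~` Q).
Proof. by move=> lQ F F' FF nQ /lQ h; apply: nQ; apply: h => a /FF[]. Qed.

Definition payoff Q A : R := (`[< Q (edges A) >])%:R.

Lemma payoff01 Q A : 0 <= payoff Q A <= 1.
Proof. by rewrite /payoff; case: `[< _ >]; rewrite ?lexx ?ler01. Qed.

Lemma payoff_setC Q A : payoff Q A + payoff (~` Q) A = 1.
Proof.
rewrite /payoff; have -> : `[< (~` Q) (edges A) >] = ~~ `[< Q (edges A) >].
  by rewrite -asbool_neg.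
by case: `[< _ >]; rewrite ?addr0 ?add0r.
Qed.

Lemma payoff_determined l Q : local l Q -> determined l (payoff Q).
Proof.
move=> lQ A B AB.
have ed A' B' : (forall x, x \in l -> A' x = B' x) -> forall a : edge e,
    (forall z, ends a z -> z \in l) -> (edges A' : set (edge e)) a -> (edges B' : set (edge e)) a.
  move=> AB' a al [x [y [Ax ea]]]; exists x, y; split => //.
  by rewrite -AB' //; apply: al; rewrite ea; left.
suff h A' B' : (forall x, x \in l -> A' x = B' x) -> Q (edges A') -> Q (edges B').
  congr (_%:R); congr nat_of_bool; apply/asboolP/asboolP; apply: h => // x xl.
  by rewrite AB.
move=> AB'; apply: lQ => a al; split; first exact: ed.
by apply: ed => // x xl; rewrite AB'.
Qed.

Lemma mu_ge_val l Q : measurable Q -> local l Q -> exists2 l', {subset l <= l'} &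
  forall n, val e p l' (payoff Q) n (fun=> None) <= pr mu Q /\
            val e p l' (payoff (~` Q)) n (fun=> None) <= 1 - pr mu Q.
Proof.
move=> mQ lQ; case: hmu => v [d [T [P [X [Y [[v' vK v'K] hN muE]]]]]].
have v_inj : injective v by exact: can_inj vK.
pose N := \max_(x <- l) (v' x).+1.
have vl z : z \in l -> exists2 j, (j < N)%N & v j = z.
  by move=> zl; exists (v' z); [apply: (leq_bigmax_seq (F := fun x => (v' x).+1))|exact: v'K].
exists [seq v j | j <- iota 0 (N - 0)].
  move=> z /vl[j jN <-]; apply/mapP; exists j => //.
  by rewrite mem_iota add0n subn0.
pose F w : config e := full_forest p v (fun x n => X x n w) (fun x n => Y x n w).
have mF : measurable_fun setT F.
  
  refine (@measurability _ _ T (config e) setT F (@edge_cylinders V e) _ _) => //.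
  move=> _ [_ [a _ <-] <-]; rewrite setTI.
  exact: (@measurable_full_forest R V e p _ _ P X Y v (measurable_srw hN) a).
have bound Q' n : measurable Q' -> local l Q' ->
    val e p [seq v j | j <- iota 0 (N - 0)] (payoff Q') n (fun=> None) <= pr mu Q'.
  move=> mQ' lQ'.
  have mG : measurable (F @^-1` Q') by rewrite -[X in measurable X]setTI; exact: mF.
  rewrite (_ : pr mu Q' = pr P (F @^-1` Q')); last by rewrite /pr muE.
  apply: (pr_ge_val hG hp hN v_inj mG) => [B|w A cA [r1 r2] Aj gA]; first exact: payoff01.
  have Qw : Q' (edges A).
    by move: gA; rewrite /payoff; case: asboolP => //; rewrite eqxx.
  apply: lQ' Qw => a al; rewrite -r2; apply: iff_sym; apply: full_forest_edge => z /al /vl[j jN <-].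
  by rewrite r1; exact: Aj.
move=> n; split; first exact: bound.
rewrite -pr_setC //; apply: bound; first exact: measurableC.
exact: local_setC.
Qed.

Lemma escape_vanishes l (k : R) : 0 < k -> exists n, forall A, closed_arrows A ->
  escape e p l setT n A <= k.
Proof.
move=> k0; have [t [N [t01 N0 hdec]]] := lescape_decay hG hp hloop.
pose k1 := k / (size l).+1%:R / 2.
have k10 : 0 < k1 by rewrite !divr_gt0.
have [m hm] := expr_lt t01 k10.
have [x xl|n hn] := @escape_starts _ _ e p hG hp l setT (k1 + k1) (ltW (addr_gt0 k10 k10)).
  have [n hn] := hdec x (m * N).+1 k1 k10; exists n => W xW.
  apply: le_trans (lescape_anti hG hp _ _ _ _ _) (le_trans (hn W xW) _).
    by move=> z _; rewrite inE.
  by rewrite lerD2r ltW // hm //= mulnK.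
exists n => A cA; apply: le_trans (hn A cA) _.
rewrite /k1 -splitr mulrCA ger_pMr // ler_pdivrMr ?ltr0n // mul1r ler_nat.
exact: leqnSn.
Qed.

Lemma mu_approx l Q (k : R) : measurable Q -> local l Q -> 0 < k ->
  exists n0, forall n, (n0 <= n)%N ->
    pr mu Q <= val e p l (payoff Q) n (fun=> None) + k /\
    val e p l (payoff Q) n (fun=> None) <= pr mu Q + k.
Proof.
move=> mQ lQ k0; have [l' ll hv] := mu_ge_val mQ lQ.
have [n0 hn0] := escape_vanishes l' k0.
exists n0 => n n0n; have [v1 v2] := hv n.
have esc : escape e p l' setT n (fun=> None) <= k.
  by apply: le_trans (hn0 (fun=> None) _) => //; exact: (escape_anti hG hp).
have s1 : val e p l (fun=> 1) n (fun=> None) <= 1.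
  have /andP[esc0 _] := escape01 hG hp l setT n (fun=> None).
  by rewrite (val1 hG hp); lra.
have s1' : 1 - k <= val e p l' (fun=> 1) n (fun=> None).
  by rewrite (val1 hG hp); lra.
have sum l1 : val e p l1 (fun=> 1) n (fun=> None) =
    val e p l1 (payoff Q) n (fun=> None) + val e p l1 (payoff (~` Q)) n (fun=> None).
  rewrite -(val_add hG hp) (_ : (fun B => _ + _) = (fun=> 1)) //.
  by apply/funext => A; rewrite payoff_setC.
have sub Q' : local l Q' -> val e p l' (payoff Q') n (fun=> None) <=
    val e p l (payoff Q') n (fun=> None).
  move=> lQ'; apply: (val_sub hG hp) => //; first exact: payoff01.
  exact: payoff_determined.
have := sub _ lQ; have := sub _ (local_setC lQ).
move: s1 s1'; rewrite !sum; lra.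
Qed.

End Approximation.

Section Correlation.
Variables (R : realType) (V : countType) (e : rel V) (p : seq V -> R).
Hypothesis hG : infinite_graph e.
Hypothesis hp : cycle_weight e p.
Hypothesis hloop : uniform_loop e p.
Variable mu : probability (config e) R.
Hypothesis hmu : is_mu_p p mu.
Implicit Types (l : seq V) (Q : set (config e)) (A B : V -> option V).

Lemma local_sub l l' Q : {subset l <= l'} -> local l Q -> local l' Q.
Proof. by move=> ll lQ F F' FF; apply: lQ => a al; apply: FF => z /al /ll. Qed.

Lemma local_setI l Q Q' : local l Q -> local l Q' -> local l (Q `&` Q').
Proof. by move=> lQ lQ' F F' FF [QF Q'F]; split; [exact: lQ FF _|exact: lQ' FF _]. Qed.

Lemma local_edge_open l (a : edge e) : (forall z, ends a z -> z \in l) ->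
  local l (edge_open a).
Proof. by move=> al F F' /(_ a al) FF; rewrite /edge_open /= => /FF. Qed.

Lemma payoff_setI Q Q' A : payoff R (Q `&` Q') A = payoff R Q A * payoff R Q' A.
Proof.
rewrite /payoff -natrM; congr (_%:R).
have -> : `[< (Q `&` Q') (edges A) >] = `[< Q (edges A) >] && `[< Q' (edges A) >].
  by rewrite -asbool_and.
by rewrite mulnb.
Qed.

(* Up to probability [k1 + k2] the walks from [l1] stay in [S1] and those from [l2] in
   the disjoint set [S2], hence the latter do not notice the former. *)
Lemma correlation_le l1 l2 Q1 Q2 (S1 S2 : set V) (k1 k2 : R) :
  measurable Q1 -> measurable Q2 -> local l1 Q1 -> local l2 Q2 ->
  (forall z, z \in S1 -> z \notin S2) ->
  (forall k : R, 0 < k -> exists n, escape e p l1 S1 n (fun=> None) <= k1 + k) ->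
  (forall k : R, 0 < k -> exists n, escape e p l2 S2 n (fun=> None) <= k2 + k) ->
  pr mu (Q1 `&` Q2) <= pr mu Q1 * pr mu Q2 + (k1 + k2).
Proof.
move=> mQ1 mQ2 lQ1 lQ2 S12 esc1 esc2; apply/ler_addgt0Pr => h h0.
have k0 : 0 < h / 8 by rewrite divr_gt0.
set k := h / 8 in k0.
have mQ := measurableI _ _ mQ1 mQ2.
have lQ : local (l1 ++ l2) (Q1 `&` Q2).
  by apply: local_setI; [apply: local_sub lQ1|apply: local_sub lQ2] => z zl;
    rewrite mem_cat zl ?orbT.
have [n1 hn1] := mu_approx hG hp hloop hmu mQ lQ k0.
have [n2 hn2] := mu_approx hG hp hloop hmu mQ1 lQ1 k0.
have [n3 hn3] := mu_approx hG hp hloop hmu mQ2 lQ2 k0.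
have [n4 hn4] := esc1 k k0.
have [n5 hn5] := esc2 k k0.
pose n := (n1 + n2 + n3 + n4 + n5)%N.
have [|u1 _] := hn1 n; first by rewrite /n; lia.
have [|_ u2] := hn2 n; first by rewrite /n; lia.
have [|_ u3] := hn3 n; first by rewrite /n; lia.
have u4 : escape e p l1 S1 n (fun=> None) <= k1 + k.
  by apply: le_trans hn4; apply: (escape_anti hG hp); rewrite /n; lia.
have u5 : escape e p l2 S2 n (fun=> None) <= k2 + k.
  by apply: le_trans hn5; apply: (escape_anti hG hp); rewrite /n; lia.
have d1 := payoff_determined R lQ1.
have d2 := payoff_determined R lQ2.
have p1 B : 0 <= payoff R Q1 B <= 1 by exact: payoff01.
have p2 B : 0 <= payoff R Q2 B <= 1 by exact: payoff01.
have m1 := pr_ge0 mu mQ1; have m2 := pr_ge0 mu mQ2.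
have e20 : 0 <= k2 + k.
  by apply: le_trans u5; case/andP: (escape01 hG hp l2 S2 n (fun=> None)).
set K := pr mu Q2 + k + (k2 + k).
have K0 : 0 <= K by rewrite /K; lra.
have step : val e p (l1 ++ l2) (fun B => payoff R Q1 B * payoff R Q2 B) n (fun=> None) <=
    K * val e p l1 (payoff R Q1) n (fun=> None) + escape e p l1 S1 n (fun=> None).
  apply: (val_cat_le hG hp) => // m B mn BS.
  apply: le_trans (val_mono hG hp l2 B p2 mn) _.
  have -> : B = join (fun=> None) B by apply/funext.
  apply: le_trans (val_join hG hp (S := S2) n p2 d2 _ _) _ => //.
    by move=> z /BS /S12.
  by rewrite /K; lra.
have -> : pr mu Q1 * pr mu Q2 + (k1 + k2) + h =
          pr mu Q1 * pr mu Q2 + (k1 + k2) + 8 * k by rewrite /k; field.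
have := step; rewrite (_ : (fun B => _ * _) = payoff R (Q1 `&` Q2)); last first.
  by apply/funext => B; rewrite payoff_setI.
have /andP[v0 v1] := val01 hG hp l1 n (fun=> None) p1.
have mle : pr mu Q2 <= 1.
  have := pr_ge0 mu (measurableC mQ2); rewrite pr_setC //; lra.
move: u1 u2 u4 v0 v1; rewrite /K.
set w := val _ _ _ _ _ _; set w' := val _ _ _ _ _ _; nra.
Qed.

Lemma escape_ball_union x y r t N : 0 <= t ->
  (forall x r (k : R), 0 < k -> exists n, forall W, x \notin W ->
      lescape e p W [set z | (gdist e x z < r)%N] x n (Active [:: x])
        <= t ^+ (r.-1 %/ N) + k) ->
  forall k : R, 0 < k -> exists n,
    escape e p [:: x; y] [set z | (gdist e x z < r)%N \/ (gdist e y z < r)%N] n (fun=> None)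
      <= 2 * t ^+ (r.-1 %/ N) + k.
Proof.
move=> t0 hdec k k0; have k20 : 0 < k / 2 by rewrite divr_gt0.
set S := [set z | _]; set c := t ^+ _.
have c0 : 0 <= c by exact: exprn_ge0.
have [z zl|n hn] := @escape_starts _ _ e p hG hp [:: x; y] S (c + k / 2) (addr_ge0 c0 (ltW k20)).
  have [n hn] := hdec z r _ k20; exists n => W zW.
  apply: le_trans (hn W zW); apply: (lescape_anti hG hp) => u; rewrite !inE /= => zu.
  by move: zl zu; rewrite !inE => /orP[]/eqP -> zu; [left|right].
by exists n; apply: le_trans (hn (fun=> None) _) _ => //=; lra.
Qed.

Lemma ball_disjoint (E1 E2 : set V) x y x' y' m r : E1 x -> E1 y -> E2 x' -> E2 y' ->
  far_apart e m E1 E2 -> (r + r <= m)%N ->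
  forall z, z \in [set z | (gdist e x z < r)%N \/ (gdist e y z < r)%N] ->
    z \notin [set z | (gdist e x' z < r)%N \/ (gdist e y' z < r)%N].
Proof.
move=> E1x E1y E2x' E2y' far rm z; rewrite inE /= => h1; rewrite notin_setE /= => h2.
suff close u u' : E1 u -> E2 u' -> (gdist e u z < r)%N -> (gdist e u' z < r)%N -> False.
  by case: h1 => h1; case: h2 => h2; apply: (close _ _ _ _ h1 h2).
move=> Eu Eu' uz uz'; have := far u u' Eu Eu'.
have := gdist_triangle hG z u u'; rewrite (gdist_sym hG z u'); lia.
Qed.

Lemma bernoulli_le (u : R) n : 0 <= u <= 1 -> 1 - n%:R * u <= (1 - u) ^+ n.
Proof.
move=> /andP[u0 u1]; elim: n => [|n IH]; first by rewrite mul0r subr0 expr0.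
rewrite exprS -natr1; apply: (@le_trans _ _ ((1 - u) * (1 - n%:R * u))).
  have : 0 <= n%:R * u ^+ 2 by rewrite mulr_ge0 // sqr_ge0.
  by rewrite expr2; nra.
by apply: ler_wpM2l => //; rewrite subr_ge0.
Qed.

Lemma decay_rate (t : R) N : 0 <= t < 1 -> (0 < N)%N ->
  exists i : R, 0 < i < 1 /\ exists m0, forall m, (m0 <= m)%N ->
    4 * t ^+ ((m./2).-1 %/ N) <= i ^+ m.
Proof.
move=> /andP[t0 t1] N0; pose u := (1 - t) / (4 * N)%:R.
have N4 : 0 < (4 * N)%:R :> R by rewrite ltr0n muln_gt0.
have u0 : 0 < u by rewrite divr_gt0 // subr_gt0.
have u1 : u < 1.
  rewrite ltr_pdivrMr // mul1r; apply: (@lt_le_trans _ _ 2); first lra.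
  by rewrite ler_nat; lia.
have tu : t <= (1 - u) ^+ (4 * N).
  apply: le_trans (bernoulli_le _ _); last by rewrite !ltW.
  by rewrite /u mulrC divfK ?gt_eqF //; lra.
have [m1 hm1] : exists k, forall n, (k <= n)%N -> (1 - u) ^+ n < 4^-1.
  by apply: expr_lt => //; rewrite ?invr_gt0 //; apply/andP; split; lra.
exists (1 - u); split; first by apply/andP; split; lra.
exists (m1 + 4 * N + 8)%N => m mm; set j := (_ %/ _)%N.
have jN : ((m./2).-1 < N * j + N)%N.
  by rewrite mulnC -mulSnr -ltn_divLR.
have u01 : 0 <= 1 - u <= 1 by apply/andP; split; lra.
have tj : t ^+ j <= (1 - u) ^+ (4 * N * j).
  by rewrite exprM; apply: lerXn2r; rewrite // nnegrE exprn_ge0 //; case/andP: u01.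
have me : (m + m1 <= 4 * N * j)%N.
  have := odd_double_half m; move: jN mm; rewrite -muln2 -mulnA; case: (odd m) => /=; lia.
have le1 : (1 - u) ^+ (4 * N * j) <= (1 - u) ^+ (m + m1).
  by case/andP: u01 => ? ?; apply: ler_wiXn2l.
have h4 := hm1 m1 (leqnn _).
have pm : 0 <= (1 - u) ^+ m by rewrite exprn_ge0 //; case/andP: u01.
move: (le_trans tj le1); rewrite exprD => h; nra.
Qed.

End Correlation.

Theorem theorem4p2p2 (R : realType) (V : countType) (e : rel V)
    (p : seq V -> R) (mu : probability (config e) R)
    (hG : infinite_graph e) (hp : cycle_weight e p) (hloop : uniform_loop e p)
    (hmu : is_mu_p p mu) :
  exists iota : R, 0 < iota < 1 /\
    \forall m \near \oo, forall e1 e2 : edge e,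
      far_apart e m (ends e1) (ends e2) ->
      (mu (edge_open e2) * mu (edge_open e1) - (iota ^+ m)%:E
         <= mu (edge_open e2 `&` edge_open e1)
         <= mu (edge_open e2) * mu (edge_open e1) + (iota ^+ m)%:E)%E.
Proof.
have [t [N [t01 N0 hdec]]] := lescape_decay hG hp hloop.
have [i [i01 [m0 hi]]] := decay_rate t01 N0.
exists i; split => //; exists m0 => // m /= /hi mi e1 e2 far.
have t0 : 0 <= t by case/andP: t01.
have [x1 [y1 [_ E1]]] := endsP e1; have [x2 [y2 [_ E2]]] := endsP e2.
have O1 := measurable_edge_open e1; have O2 := measurable_edge_open e2.
have loc (a : edge e) x y : ends a = [set x; y] -> local [:: x; y] (edge_open a).
  move=> Ea; apply: local_edge_open => z; rewrite Ea /= => -[] ->; rewrite !inE eqxx ?orbT //.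
have m2 : (m./2 + m./2 <= m)%N by rewrite addnn -{2}(odd_double_half m) leq_addl.
have disj := @ball_disjoint _ _ hG _ _ x1 y1 x2 y2 m m./2 _ _ _ _ far m2.
rewrite E1 E2 in disj.
have esc x y := @escape_ball_union _ _ _ _ hG hp x y m./2 t N t0 hdec.
have cor Q2 : measurable Q2 -> local [:: x2; y2] Q2 ->
    pr mu (edge_open e1 `&` Q2) <= pr mu (edge_open e1) * pr mu Q2 + i ^+ m.
  move=> mQ2 lQ2; apply: le_trans (correlation_le hG hp hloop hmu O1 mQ2 (loc _ _ _ E1) lQ2
    (disj _ _ _ _) (esc x1 y1) (esc x2 y2)) _; try by [left|right].
  by rewrite lerD2l; apply: le_trans mi; lra.
have up := cor _ O2 (loc _ _ _ E2).
have dn := cor _ (measurableC O2) (local_setC (loc _ _ _ E2)).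
rewrite pr_setC // in dn.
have split1 := pr_split mu O1 O2.
rewrite setIC !prE //; last exact: measurableI.
rewrite -EFinM -EFinB -EFinD !lee_fin; apply/andP; split; lra.
Qed.
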